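(* Let $\wedge_2\mathbb{R}^n=\{A\in\mathbb{R}^{n\times n}: a_{ij}+a_{ji}=0 \text{ for all } i,j\}$ be the space of skew-symmetric matrices. The open cones in $\wedge_2\mathbb{R}^n$ on which the tropical eigenpair map for skew-symmetric matrices is represented by distinct and unique linear functions are the (relative interiors of the) cones $\Omega_\phi\cap\wedge_2\mathbb{R}^n$, where $\phi$ runs over all kites on $[n]$. Each such cone has $n(n-3)$ facets, so it is not simplicial, but it is linearly isomorphic to $\mathbb{R}^{n-1}$ times the cone over the standard cube of dimension $n(n-3)/2=\binom{n}{2}-n$. This collection of cones does not form a fan for $n\ge 6$.
   Context: Max-plus arithmetic: $u\oplus v=\max\{u,v\}$, $u\odot v=u+v$. A tropical eigenpair of $A\in\mathbb{R}^{n\times n}$ is $(\lambda,x)\in\mathbb{R}\times\mathbb{R}^n$ with $\max_j(a_{ij}+x_j)=\lambda+x_i$ for all $i$; eigenvectors are taken in $\mathbb{TP}^{n-1}=\mathbb{R}^n/\mathbb{R}(1,\dots,1)$, the eigenvalue $\lambda(A)$ is unique (maximum cycle mean of the complete weighted digraph on $[n]$ with loops), and for generic $A$ the eigenvector $x(A)$ is unique. A function $\phi:[n]\to[n]$ is connected if its graph (edges $i\to\phi(i)$) is connected as an undirected graph; it then has a unique cycle. A kite is a connected function whose cycle has length at least $3$. For a generic matrix $A$ (unique cycle of maximal mean, the critical cycle, and for every vertex $i$ and every critical vertex $\ell$ a unique simple directed path from $i$ to $\ell$ of maximal total weight w.r.t. weights $a_{ij}-\lambda(A)$), the critical graph of $A$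 consists of the critical cycle together with, for each non-critical vertex $i$, the edges of the maximal path from $i$ to the unique critical vertex $i^\ast$ for which this path avoids the edges of the critical cycle; it is the graph of a connected function. For a connected function $\phi$, $\Omega_\phi\subseteq\mathbb{R}^{n\times n}$ is the closure of the set of generic matrices with critical graph $\phi$; it is a convex polyhedral cone on which the eigenpair map is linear.
   Formalization: Stated for n ≥ 3 (for n = 1, 2 there are no kites but the eigenpair map is linear on the whole space), and the facet count and non-simpliciality only for n ≥ 4 (for n = 3 each cone is a half-space, which has one facet and is simplicial). *)

(* Defs.v *)
From HB Require Import structures.
From mathcomp Require Import all_boot all_order all_algebra.
From mathcomp Require Import all_classical all_reals all_analysis.

Set Implicit Arguments.
Unset Strict Implicit.
Unset Printing Implicit Defensive.

Import Order.TTheory GRing.Theory Num.Theory.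
Import numFieldNormedType.Exports.

Local Open Scope classical_set_scope.
Local Open Scope ring_scope.

Section Polyhedral.
Context {R : realType}.

Section Lmodule.
Context {V : lmodType R}.

Definition convex_cone (C : set V) : Prop :=
  (forall (a : R) v, 0 < a -> C v -> C (a *: v)) /\
  (forall v w, C v -> C w -> C (v + w)).

Definition polyhedral_cone (C : set V) : Prop :=
  exists (k : nat) (l : 'I_k -> {linear V -> R^o}),
    C = [set v | forall i, 0 <= l i v].

(* The functional l = 0 is allowed, so that a cone is a face of itself. *)
Definition face (C F : set V) : Prop :=
  exists l : {linear V -> R^o},
    (forall v, C v -> 0 <= l v) /\ F = [set v | C v /\ l v = 0].

Definition fan (S : set (set V)) : Prop :=
  [/\ finite_set S,
      (forall C, S C -> polyhedral_cone C),
      (forall C F, S C -> face C F -> S F) &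
      (forall C D, S C -> S D -> face C (C `&` D) /\ face D (C `&` D))].

Definition all_faces (S : set (set V)) : set (set V) :=
  [set F | exists2 C, S C & face C F].

Definition affine_hull (C : set V) : set V :=
  [set v | exists (k : nat) (c : 'I_k -> R) (p : 'I_k -> V),
    [/\ forall i, C (p i), \sum_i c i = 1 & v = \sum_i c i *: p i]].

End Lmodule.

Section Vector.
Context {V : vectType R}.

Definition linear_span (S : set V) (W : {vspace V}) : Prop :=
  (forall v, S v -> v \in W) /\
  (forall W' : {vspace V}, (forall v, S v -> v \in W') -> (W <= W')%VS).

(* Cones contain 0, so their dimension is that of their linear span. *)
Definition facet (C F : set V) : Prop :=
  face C F /\
  exists WC WF : {vspace V},
    [/\ linear_span C WC, linear_span F WF & \dim WC = (\dim WF).+1].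

(* Cones may have a nontrivial lineality space L: simplicial means linearly
   isomorphic to L x (R_{>=0})^k. *)
Definition simplicial_cone (C : set V) : Prop :=
  exists (L : {vspace V}) (k : nat) (s : k.-tuple V),
    [/\ free s, (L :&: span s)%VS = 0%VS &
        C = [set v | exists2 u, u \in L &
               exists2 c : 'I_k -> R, (forall i, 0 <= c i) &
                 v = u + \sum_(i < k) c i *: tnth s i]].

End Vector.

Definition standard_cube (m : nat) : set 'rV[R]_m :=
  [set p | forall i, -1 <= p 0 i <= 1].

Definition cone_over (m : nat) (P : set 'rV[R]_m) : set (R^o * 'rV[R]_m)%type :=
  [set q | exists (t : R) (p : 'rV[R]_m), [/\ 0 <= t, P p & q = (t, t *: p)]].

End Polyhedral.

Section Functions.
Context {n : nat}.
Implicit Type phi : {ffun 'I_n -> 'I_n}.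

Definition connected_function phi : Prop :=
  forall i j, connect [rel u v | (phi u == v) || (phi v == u)] i j.

Definition kite phi : Prop :=
  connected_function phi /\
  exists c : seq 'I_n, ufcycle phi c /\ (3 <= size c)%N.

End Functions.

Section Tropical.
Context {R : realType} {n : nat}.
Implicit Types (A : 'M[R]_n) (x y : 'cV[R]_n) (phi : {ffun 'I_n -> 'I_n}).

(* max_j (a_ij + x_j) = lam + x_i for all i; the maximum is seeded with its
   own term j = i. *)
Definition eigenpair A (lam : R) x : Prop :=
  forall i, \big[Num.max/(A i i + x i 0)]_(j < n) (A i j + x j 0) = lam + x i 0.

(* equality in TP^(n-1) = R^n / R(1,...,1) *)
Definition tp_eq x y : Prop := exists c : R, x = y + const_mx c.

Definition unique_eigenpair A (lam : R) x : Prop :=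
  eigenpair A lam x /\
  forall mu y, eigenpair A mu y -> mu = lam /\ tp_eq y x.

(* A cycle is the sequence of its distinct vertices in cyclic order; sequences
   that differ by a rotation are the same cycle. *)
Definition simple_cycle (c : seq 'I_n) : Prop := c <> [::] /\ uniq c.

Definition cycle_edges (c : seq 'I_n) : seq ('I_n * 'I_n) :=
  [seq (i, next c i) | i <- c].

Definition cycle_mean A (c : seq 'I_n) : R :=
  (\sum_(e <- cycle_edges c) A e.1 e.2) / (size c)%:R.

Definition trop_eigenvalue A : R := sup [set cycle_mean A c | c in simple_cycle].

Definition critical_cycle A (c : seq 'I_n) : Prop :=
  simple_cycle c /\
  forall c', simple_cycle c' -> cycle_mean A c' <= cycle_mean A c.

(* The path from i with vertices i :: p. *)
Definition path_edges (i : 'I_n) (p : seq 'I_n) : seq ('I_n * 'I_n) :=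
  zip (belast i p) p.

Definition simple_path (i l : 'I_n) (p : seq 'I_n) : Prop :=
  uniq (i :: p) /\ last i p = l.

Definition path_weight A (i : 'I_n) (p : seq 'I_n) : R :=
  \sum_(e <- path_edges i p) (A e.1 e.2 - trop_eigenvalue A).

Definition maximal_path A (i l : 'I_n) (p : seq 'I_n) : Prop :=
  simple_path i l p /\
  forall q, simple_path i l q -> path_weight A i q <= path_weight A i p.

Definition generic A : Prop :=
  exists c, [/\ critical_cycle A c,
    (forall c', critical_cycle A c' -> exists k, c' = rot k c) &
    (forall i l, l \in c -> exists! p, maximal_path A i l p)].

Definition critical_edge A (i j : 'I_n) : Prop :=
  exists2 c, critical_cycle A c &
    (i, j) \in cycle_edges c \/
    exists (v l : 'I_n) (p : seq 'I_n),
      [/\ v \notin c, l \in c, maximal_path A v l p,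
          {in path_edges v p, forall e, e \notin cycle_edges c} &
          (i, j) \in path_edges v p].

Definition critical_graph A phi : Prop :=
  forall i j, critical_edge A i j <-> phi i = j.

Definition Omega phi : set 'M[R]_n :=
  closure [set A | generic A /\ critical_graph A phi].

Definition skew_symmetric : set 'M[R]_n := [set A | forall i j, A i j + A j i = 0].

Definition skew_cone phi : set 'M[R]_n := Omega phi `&` skew_symmetric.

Definition relint (C : set 'M[R]_n) : set 'M[R]_n :=
  [set A | C A /\ \forall B \near A, affine_hull C B -> C B].

Definition open_in_skew (U : set 'M[R]_n) : Prop :=
  exists2 W : set 'M[R]_n, open W & U = W `&` skew_symmetric.

(* Maps from the skew-symmetric matrices to R x TP^(n-1) are given by lifts to
   R x R^n; values outside that space are irrelevant. *)
Definition skew_linear (f : 'M[R]_n -> R * 'cV[R]_n) : Prop :=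
  forall (a : R) A B, skew_symmetric A -> skew_symmetric B ->
    (f (a *: A + B)).1 = a * (f A).1 + (f B).1 /\
    tp_eq (f (a *: A + B)).2 (a *: (f A).2 + (f B).2).

Definition skew_map_eq (f g : 'M[R]_n -> R * 'cV[R]_n) : Prop :=
  forall A, skew_symmetric A -> (f A).1 = (g A).1 /\ tp_eq (f A).2 (g A).2.

Definition linear_representation (U : set 'M[R]_n)
    (f : 'M[R]_n -> R * 'cV[R]_n) : Prop :=
  skew_linear f /\ forall A, U A -> unique_eigenpair A (f A).1 (f A).2.

Definition linearity_cone (U : set 'M[R]_n) : Prop :=
  [/\ U !=set0, open_in_skew U, convex_cone U &
      exists f, linear_representation U f].

Definition maximal_linearity_cone (U : set 'M[R]_n) : Prop :=
  linearity_cone U /\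
  forall U', linearity_cone U' -> U `<=` U' -> U' = U.

Definition kite_cones : set (set 'M[R]_n) :=
  [set C | exists2 phi, kite phi & C = skew_cone phi].

End Tropical.

Arguments standard_cube R m : clear implicits.
Arguments skew_symmetric R n : clear implicits.
Arguments skew_cone R {n} phi.
Arguments kite_cones R n : clear implicits.

(* Main.v *)
Require Import Defs.
From HB Require Import structures.
From mathcomp Require Import all_boot all_order all_algebra.
From mathcomp Require Import all_classical all_reals all_analysis.
From mathcomp Require Import ring lra zify.

Set Implicit Arguments.
Unset Strict Implicit.
Unset Printing Implicit Defensive.

Import Order.TTheory GRing.Theory Num.Theory.
Import numFieldNormedType.Exports.

Local Open Scope classical_set_scope.
Local Open Scope ring_scope.

(** Write s_ij = lam + x_i - x_j - a_ij for the slack of a pair (lam, x).  A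
    connected function phi determines (lam, x), linearly in A, by requiring that
    all slacks s_(i, phi i) vanish, and Omega_phi is the cone on which the
    remaining slacks are nonnegative.  On skew-symmetric matrices
    s_ij + s_ji = 2 lam, so for a kite the slack of each of the n(n-3)/2
    unordered pairs that are not edges of phi ranges freely over [0, 2 lam], while
    x ranges freely over R^n modulo constants: this is R^(n-1) times the cone over
    a cube.  In the interior of the cone the only vanishing slacks are those of the
    edges of phi, which gives uniqueness of the eigenpair and recovers phi from its
    linear map.  A skew-symmetric matrix with lam > 0 has no critical cycle of
    length at most 2, and every matrix has an eigenpair whose zero-slack graph
    contains a connected function; hence the cones of the kites cover the
    skew-symmetric matrices up to a proper subspace.  For n >= 6 the cones of two
    kites whose cycles are disjoint triangles do not meet in a common face. *)

(** * Edges of paths and cycles, and telescoping sums along them *)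

Section Edges.
Context {n : nat}.
Implicit Types (i j : 'I_n) (p : seq 'I_n).

(** Opening a cycle at its first vertex reduces sums over cycles to sums over paths. *)
Lemma cycle_edges_cons i p :
  uniq (i :: p) -> cycle_edges (i :: p) = path_edges i (rcons p i).
Proof.
move=> uc; rewrite /path_edges belast_rcons /cycle_edges.
have -> : rcons p i = [seq next (i :: p) j | j <- i :: p].
  apply: (@eq_from_nth _ i) => [|k]; first by rewrite size_rcons size_map.
  rewrite size_rcons => kp; rewrite (nth_map i) // next_nth mem_nth //.
  rewrite index_uniq // nth_rcons; case: ltngtP => // [|->]; last first.
    by rewrite nth_default.
  by move=> pk; move: kp; rewrite ltnS leqNgt pk.
by elim: {2 3 5}(i :: p) => //= j s <-.
Qed.

Lemma path_edges_cat i p q :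
  path_edges i (p ++ q) = path_edges i p ++ path_edges (last i p) q.
Proof. by elim: p i => //= j p IH i; rewrite /path_edges /= -IH. Qed.

Lemma path_edges_all (P : rel 'I_n) i p :
  {in path_edges i p, forall e, P e.1 e.2} <-> path P i p.
Proof.
elim: p i => //= j p IH i; rewrite /path_edges /= -/(path_edges j p); split.
  move=> H; rewrite (H (i, j)) ?mem_head //=; apply/IH => e ep.
  by apply: H; rewrite inE ep orbT.
by case/andP=> Pij /IH H e; rewrite inE => /predU1P[->//|]; apply: H.
Qed.

Lemma path_edges_source i p e : e \in path_edges i p -> e.1 \in belast i p.
Proof.
elim: p i => //= j p IH i; rewrite /path_edges /= !inE.
by case/predU1P=> [->|/IH ->]; rewrite ?eqxx ?orbT.
Qed.

Lemma path_edgesS (V : nmodType) (F : 'I_n * 'I_n -> V) i j p :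
  \sum_(e <- path_edges i (j :: p)) F e =
  F (i, j) + \sum_(e <- path_edges j p) F e.
Proof. by rewrite /path_edges /= big_cons. Qed.

Lemma path_telescope (V : zmodType) (x : 'I_n -> V) i p :
  \sum_(e <- path_edges i p) (x e.1 - x e.2) = x i - x (last i p).
Proof.
elim: p i => [|j p IH] i; first by rewrite /path_edges big_nil subrr.
by rewrite path_edgesS IH /= addrA subrK.
Qed.

Lemma cycle_telescope (V : zmodType) (x : 'I_n -> V) c :
  uniq c -> \sum_(e <- cycle_edges c) (x e.1 - x e.2) = 0.
Proof.
case: c => [|i p] uc; first by rewrite big_nil.
by rewrite cycle_edges_cons // path_telescope last_rcons subrr.
Qed.

End Edges.

(** * Tools for finite graphs: invariance, maximisation, policies *)

Lemma fconnect_closed (T : finType) (f : T -> T) (P : pred T) x y :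
  (forall z, P z -> P (f z)) -> fconnect f x y -> P x -> P y.
Proof.
move=> Pf /iter_findex <- Px; by elim: (findex f x y) => //= k; apply: Pf.
Qed.

(** Sequences without repetition have length at most [#|T|], so they live in a finite type of
    bounded sequences, where a maximum exists. *)
Lemma max_uniq_seq (R : realDomainType) (T : finType) (P : pred (seq T))
    (F : seq T -> R) p0 :
  (forall p, P p -> uniq p) -> P p0 ->
  exists2 p, P p & forall q, P q -> F q <= F p.
Proof.
move=> Pu Pp0; have bsz p : P p -> (size p <= #|T|)%N.
  by move/Pu/card_uniqP <-; apply: max_card.
have := @arg_maxP _ R _ (Bseq (bsz _ Pp0)) (fun p => P (val p))
          (fun p => F (val p)) Pp0.
case=> p Pp pmax; exists (val p) => // q Pq.
exact: (pmax (Bseq (bsz _ Pq))).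
Qed.

(* A policy following shortest paths: it strictly decreases the distance to r. *)
Lemma rooted_policy (T : finType) (G : rel T) r :
  (forall i, connect G i r) -> (exists j, G r j) ->
  exists psi : T -> T, (forall i, G i (psi i)) /\ forall i, fconnect psi i r.
Proof.
move=> Gr [j0 Grj].
pose P i k := [exists p : k.-tuple T, path G i p && (last i p == r)].
have exP i : exists k, P i k.
  have /connectP[p Gp lp] := Gr i; exists (size p).
  by apply/existsP; exists (in_tuple p); rewrite Gp /= -lp.
pose h i := ex_minn (exP i).
have step i : exists j, G i j /\ (i != r -> (h j < h i)%N).
  have [->|ir] := eqVneq i r; first by exists j0.
  rewrite {2}/h; case: ex_minnP => k /existsP[[p sp] /= +] _.
  move/eqP: sp => <-; case: p => [|j p] /=; first by rewrite (negPf ir).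
  case/andP=> /andP[Gij Gp] lp; exists j; split=> // _.
  rewrite ltnS /h; case: ex_minnP => m _; apply.
  by apply/existsP; exists (in_tuple p); rewrite Gp.
have [psi psiP] := choice step; exists psi; split=> i; first by case: (psiP i).
have [k] := ubnP (h i); elim: k i => // k IH i; rewrite ltnS => hk.
have [->//|ir] := eqVneq i r.
apply: connect_trans (fconnect1 _ _) (IH _ _).
by apply: leq_trans hk; case: (psiP i) => _ /(_ ir).
Qed.

(** * Slacks, cycle means, and existence of a pair with nonnegative slacks *)

Section Slack.
Context {R : realType} {n : nat}.
Implicit Types (A : 'M[R]_n) (x : 'I_n -> R) (i j r : 'I_n).

Definition slack A (lam : R) x i j : R := lam + x i - x j - A i j.

(** The potential terms telescope: among paths with common endpoints, larger weight means smaller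
    total slack. *)
Lemma path_slack A lam x i p :
  \sum_(e <- path_edges i p) (A e.1 e.2 - lam) =
  x i - x (last i p) - \sum_(e <- path_edges i p) slack A lam x e.1 e.2.
Proof.
rewrite -path_telescope -sumrB; apply: eq_bigr => e _; rewrite /slack; ring.
Qed.

Lemma cycle_slack A lam x c : uniq c ->
  \sum_(e <- cycle_edges c) A e.1 e.2 =
  (size c)%:R * lam - \sum_(e <- cycle_edges c) slack A lam x e.1 e.2.
Proof.
move=> uc; have <- : \sum_(e <- cycle_edges c) lam = (size c)%:R * lam.
  by rewrite big_const_seq count_predT size_map iter_addr_0 mulr_natl.
rewrite -[X in _ = X - _]addr0 -[X in _ + X - _](cycle_telescope x uc).
rewrite -big_split -sumrB; apply: eq_bigr => e _; rewrite /slack /=; ring.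
Qed.

Lemma sum_slack_eq0 A lam x (s : seq ('I_n * 'I_n)) :
  (forall i j, 0 <= slack A lam x i j) ->
  \sum_(e <- s) slack A lam x e.1 e.2 <= 0 ->
  {in s, forall e, slack A lam x e.1 e.2 = 0}.
Proof.
move=> s0 sle e es; apply/eqP.
have : \sum_(e <- s) slack A lam x e.1 e.2 == 0.
  by rewrite eq_le sle sumr_ge0.
by rewrite psumr_eq0 // => /allP /(_ _ es).
Qed.

Lemma cycle_mean_le A lam x c : (forall i j, 0 <= slack A lam x i j) ->
  simple_cycle c -> cycle_mean A c <= lam.
Proof.
move=> s0 [c0 uc]; have sc : 0 < (size c)%:R :> R.
  by rewrite ltr0n; case: c c0 {uc}.
rewrite /cycle_mean ler_pdivrMr // mulrC (cycle_slack A lam x uc) gerBl.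
exact: sumr_ge0.
Qed.

(** Around a cycle the potentials cancel, so the mean is [lam] minus the average slack. *)
Lemma cycle_meanP A lam x c : (forall i j, 0 <= slack A lam x i j) ->
  simple_cycle c ->
  cycle_mean A c = lam <->
  {in cycle_edges c, forall e, slack A lam x e.1 e.2 = 0}.
Proof.
move=> s0 [c0 uc]; have sc : (size c)%:R != 0 :> R.
  by rewrite pnatr_eq0; case: c c0 {uc}.
rewrite /cycle_mean (cycle_slack A lam x uc); split=> [|H].
  move=> /(congr1 ( *%R^~ (size c)%:R)); rewrite mulfVK // mulrC => E.
  apply: sum_slack_eq0 => //; move: E; lra.
rewrite big_seq big1 ?subr0 ?[_%:R * _]mulrC ?mulfK // => e; exact: H.
Qed.

(** Take [lam] to be the maximal cycle mean, [r] a vertex of a cycle attaining it, and [x i] the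
    weight of a heaviest simple path from [i] to [r] for the weights [A i j - lam]. Heaviest paths
    have zero slack along them, so [r] is reached from everywhere in the zero-slack graph and
    [rooted_policy] applies. *)
Lemma nonneg_slack_root A (i0 : 'I_n) :
  exists lam x r, (forall i j, 0 <= slack A lam x i j) /\
    exists psi : 'I_n -> 'I_n,
      (forall i, slack A lam x i (psi i) = 0) /\ forall i, fconnect psi i r.
Proof.
have [c] := @max_uniq_seq R _ (fun c : seq 'I_n => (c != [::]) && uniq c)
  (cycle_mean A) [:: i0] (fun c => @proj2 _ _ \o elimT andP) isT.
case: c => // r c0 /= uc cmax; set lam := cycle_mean A (r :: c0) in cmax.
pose w (e : 'I_n * 'I_n) := A e.1 e.2 - lam.
pose W i p := \sum_(e <- path_edges i p) w e.
have Wcycle i p : uniq (i :: p) ->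
    W i (rcons p i) = (size p).+1%:R * (cycle_mean A (i :: p) - lam).
  move=> uip; rewrite /W -cycle_edges_cons // sumrB big_const_seq count_predT.
  rewrite size_map iter_addr_0 /cycle_mean /= mulrBr mulrC mulfVK ?mulr_natl //.
have Wle0 i p : uniq (i :: p) -> W i (rcons p i) <= 0.
  move=> uip; rewrite Wcycle // pmulr_rle0 ?ltr0n // subr_le0.
  exact: (cmax (i :: p)).
have ex_d i : exists p, (uniq (i :: p) && (last i p == r)) /\
    forall q, uniq (i :: q) && (last i q == r) -> W i q <= W i p.
  have [||p pP pmax] := @max_uniq_seq R _
    (fun p => uniq (i :: p) && (last i p == r)) (W i)
    (* The graph is complete, so the direct edge is a candidate path. *)
    (if i == r then [::] else [:: r]).
  - by move=> p /andP[/= /andP[]].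
  - by case: eqVneq => /= [->|ir]; rewrite ?eqxx ?inE ?ir.
  - by exists p.
have [b bP] := choice ex_d; pose x i := W i (b i).
have tri i j : w (i, j) + x j <= x i.
  have [/andP[ub lb] _] := bP j; have [_ bmax] := bP i.
  have -> : w (i, j) + x j = W i (j :: b j) by rewrite /W path_edgesS.
  have [ib|ib] := boolP (i \in j :: b j); last first.
    by apply: bmax; rewrite cons_uniq ib ub lb.
  (* If the path from [j] returns to [i], cut it there: the first piece closes a cycle at [i] of
     nonpositive weight, and the rest is a simple path from [i] to [r]. *)
  move: ub lb; rewrite -[last j _]/(last i (j :: b j)).
  case/splitPr: ib => q1 q2.
  rewrite last_cat cat_uniq /= => /and3P[uq1 + /andP[iq2 uq2]] lq2.
  rewrite negb_or => /andP[iq1 _].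
  rewrite /W -cat_rcons path_edges_cat big_cat last_rcons -!/(W _ _) /=.
  rewrite -[x i]add0r lerD //; first by apply: Wle0; rewrite /= iq1.
  by apply: bmax; rewrite lq2 /= iq2 uq2.
(* The only simple path from [r] to itself is the empty one. *)
have xr : x r = 0.
  have [/andP[/= /andP[+ _] lb] _] := bP r; rewrite /x.
  case: (b r) lb => [|j q]; first by rewrite /W /path_edges big_nil.
  by move=> /= /eqP {1}<-; rewrite mem_last.
have s0 i j : 0 <= slack A lam x i j.
  by have := tri i j; rewrite /slack /w /=; lra.
have bP0 i : path [rel u v | slack A lam x u v == 0] i (b i).
  apply/path_edges_all => e eb; apply/eqP.
  move: e eb; apply: (sum_slack_eq0 s0).
  have := path_slack A lam x i (b i); rewrite -/(W _ _) -/(x i).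
  by have [/andP[_ /eqP ->] _] := bP i; rewrite xr; lra.
have [||psi [psi0 psir]] :=
    @rooted_policy _ [rel u v | slack A lam x u v == 0] r.
- move=> i; apply/connectP; exists (b i) => //.
  by have [/andP[_ /eqP ->]] := bP i.
(* The maximal cycle supplies a zero-slack edge leaving [r]. *)
- exists (next (r :: c0) r) => /=; apply/eqP.
  apply: (proj1 (cycle_meanP (c := r :: c0) s0 _) _ (r, next (r :: c0) r)) => //.
  by apply/mapP; exists r; rewrite ?mem_head.
exists lam, x, r; split=> //; exists psi; split=> // i; exact/eqP/psi0.
Qed.

End Slack.

(** * Paths along a function, and kites *)

Section FunctionPaths.
Variables (n : nat) (f : 'I_n -> 'I_n).
Implicit Types (i l r : 'I_n) (p : seq 'I_n).

Definition orbit_path i l := traject f (f i) (findex f i l).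

Lemma orbit_path_simple i l : fconnect f i l -> simple_path i l (orbit_path i l).
Proof.
move=> il; split; last by rewrite last_traject iter_findex.
rewrite -trajectS -(@take_traject _ f (fingraph.order f i)) ?findex_max //.
by rewrite take_uniq // orbit_uniq.
Qed.

(** A path following [f] without repeating a vertex is no longer than the orbit, so its length is
    the index of the first visit to its endpoint. *)
Lemma orbit_path_uniq i l p :
  fpath f i p -> simple_path i l p -> p = orbit_path i l.
Proof.
move=> /fpathE pE [up lp]; rewrite /orbit_path -lp {2}pE last_traject.
rewrite findex_iter //; move: up; rewrite {1}pE -trajectS => up.
rewrite -size_orbit -(size_traject f i (size p).+1).
apply: uniq_leq_size up _ => j /trajectP[k _ ->].
by rewrite -fconnect_orbit fconnect_iter.
Qed.

Lemma fcycle_root r c : (forall i, fconnect f i r) ->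
  simple_cycle c -> fcycle f c -> r \in c.
Proof.
move=> fr [+ _] fc; case: c fc => // i c fc _.
by rewrite -(fconnect_cycle fc (mem_head i c)) fr.
Qed.

Lemma root_fcycle r : (forall i, fconnect f i r) -> fcycle f (orbit f r).
Proof. by move=> fr; rewrite -fconnect_f. Qed.

End FunctionPaths.

(** A rooted form of the definition: some vertex is reached from everywhere, and fixed points and
    2-cycles are absent. It replaces undirected connectedness by [fconnect] in everything that
    follows. *)
Lemma kiteP (n : nat) (phi : {ffun 'I_n -> 'I_n}) :
  kite phi <->
  exists r, (forall i, fconnect phi i r) /\ forall i, phi (phi i) != i.
Proof.
split=> [[conn [c [/andP[fc uc] sc]]]|[r [phir phi2]]].
  case: c fc uc sc => [|r [|a [|b c]]] // fc uc _; exists r.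
  have cyc : fconnect phi (phi r) r.
    by rewrite fconnect_f (orbitE fc uc (mem_head _ _)) rot_cycle.
  (* Walk along an undirected path from [r]: an edge traversed forwards stays within reach of [r]
     because [r] lies on a cycle; one traversed backwards does so trivially. *)
  have phir i : fconnect phi i r.
    have /connectP[p] := conn r i; elim/last_ind: p i => [|p j IH] i.
      by move=> _ ->.
    rewrite rcons_path last_rcons => /andP[/IH/(_ erefl) + + ->] /=.
    set k := last r p => kr /orP[/eqP <-|/eqP jk]; last first.
      by rewrite -jk in kr; apply: connect_trans (fconnect1 _ _) kr.
    move: kr; rewrite fconnect_eqVf => /predU1P[->//|//].
  (* Points fixed by the second iterate are closed under [phi], so one such point would make [r]
     one, although its cycle has at least three vertices. *)
  split=> // i; apply/eqP => phi2.
  have /andP[/eqP ra /andP[/eqP ab _]] := fc.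
  have /eqP : phi (phi r) == r.
    apply: (@fconnect_closed _ phi (fun j => phi (phi j) == j) _ _ _ (phir i)).
      by move=> j /eqP->.
    by rewrite phi2.
  rewrite ra ab => br; move: uc.
  by rewrite br /= !inE eqxx !orbT.
split=> [i j|].
  have sym : connect_sym [rel u v | (phi u == v) || (phi v == u)].
    by apply: sym_connect_sym => u v /=; rewrite orbC.
  have toroot u : connect [rel u v | (phi u == v) || (phi v == u)] u r.
    apply: connect_sub (phir u) => v w /= /eqP <-.
    by apply: connect1; rewrite /= eqxx.
  by apply: connect_trans (toroot i) _; rewrite sym.
exists (orbit phi r); have fc := root_fcycle phir; split.
  by rewrite /ucycle /ucycleb fc orbit_uniq.
move: fc (in_orbit phi r); case: (orbit phi r) => [|i [|j [|//]]] //=.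
  by rewrite andbT inE => /eqP ii /eqP ri; have := phi2 i; rewrite !ii eqxx.
by case/and3P=> /eqP ij /eqP ji _; have := phi2 i; rewrite ij ji eqxx.
Qed.

(** * Critical cycles and maximal paths read off from zero slacks *)

Section Tight.
Context {R : realType} {n : nat}.
Variables (A : 'M[R]_n) (lam : R) (x : 'I_n -> R) (psi : 'I_n -> 'I_n).
Variable r : 'I_n.
Hypothesis s_ge0 : forall i j, 0 <= slack A lam x i j.
Hypothesis s_psi : forall i, slack A lam x i (psi i) = 0.
Hypothesis psir : forall i, fconnect psi i r.

Let orbitS : simple_cycle (orbit psi r).
Proof.
by split=> [E|]; [have := in_orbit psi r; rewrite E|apply: orbit_uniq].
Qed.

Let orbitM : cycle_mean A (orbit psi r) = lam.
Proof.
apply/(cycle_meanP s_ge0 orbitS) => e /mapP[i ic ->] /=.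
by rewrite (nextE (root_fcycle psir) ic).
Qed.

Lemma tight_critical_cycle c :
  critical_cycle A c <->
  simple_cycle c /\ {in cycle_edges c, forall e, slack A lam x e.1 e.2 = 0}.
Proof.
split=> [[sc cmax]|[sc /(cycle_meanP s_ge0 sc) cm]]; split=> //.
  apply/(cycle_meanP s_ge0 sc)/eqP; rewrite eq_le (cycle_mean_le s_ge0) //=.
  by rewrite -{1}orbitM cmax.
by move=> c' sc'; rewrite cm (cycle_mean_le s_ge0).
Qed.

Lemma tight_eigenvalue : trop_eigenvalue A = lam.
Proof.
have ub : ubound [set cycle_mean A c | c in simple_cycle] lam.
  by move=> _ [c sc <-]; apply: cycle_mean_le s_ge0 sc.
apply/eqP; rewrite eq_le; apply/andP; split.
  by apply: ge_sup => //; exists lam; exists (orbit psi r).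
by apply: ub_le_sup; [exists lam|exists (orbit psi r)].
Qed.

Lemma tight_path_weight i p :
  path_weight A i p =
  x i - x (last i p) - \sum_(e <- path_edges i p) slack A lam x e.1 e.2.
Proof. by rewrite /path_weight tight_eigenvalue (path_slack _ _ x). Qed.

(** The path along [psi] has zero total slack, so any maximal path must reach that value too. *)
Lemma tight_maximal_path i l p : fconnect psi i l ->
  maximal_path A i l p <->
  simple_path i l p /\
  {in path_edges i p, forall e, slack A lam x e.1 e.2 = 0}.
Proof.
move=> il; split=> [[sp pmax]|[sp p0]]; split=> //.
  apply: sum_slack_eq0 => //; have [_ lp] := sp.
  have sq := orbit_path_simple il; have [_ lq] := sq.
  have := pmax _ sq; rewrite !tight_path_weight lp lq.
  rewrite [X in _ - _ - X <= _]big_seq [X in _ - _ - X <= _]big1; first lra.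
  move=> e /(proj2 (path_edges_all (frel psi) i _) (fpath_traject _ _ _)).
  by move=> /= /eqP <-; apply: s_psi.
move=> q [uq lq]; have [_ lp] := sp; rewrite !tight_path_weight lp lq.
rewrite [X in _ <= _ - _ - X]big_seq [X in _ <= _ - _ - X]big1 ?subr0 ?gerBl //.
exact: sumr_ge0.
Qed.

(** Uniqueness of the critical cycle makes it the orbit of [r] up to rotation, so [psi] reaches the
    end of every path in the critical graph and [tight_maximal_path] applies. *)
Lemma critical_graph_slack (phi : 'I_n -> 'I_n) i :
  generic A -> critical_edge A i (phi i) -> slack A lam x i (phi i) = 0.
Proof.
case=> c0 [cc0 cuniq _] [c cc]; have [sc c0P] := (tight_critical_cycle c).1 cc.
case=> [/c0P //|[v [l [p [vc lc pmax pc ip]]]]].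
suff vl : fconnect psi v l.
  by have [_ /(_ _ ip)] := (tight_maximal_path p vl).1 pmax.
apply: connect_trans (psir v) _; rewrite fconnect_orbit.
have /cuniq[k ->] : critical_cycle A (orbit psi r).
  by apply/tight_critical_cycle; split=> //; apply/(cycle_meanP s_ge0 orbitS).
by have [k' cE] := cuniq _ cc; rewrite mem_rot; rewrite cE mem_rot in lc.
Qed.

Section Strict.
Hypothesis s_strict : forall i j, slack A lam x i j = 0 -> psi i = j.

Let critical_fcycle c :
  critical_cycle A c <-> simple_cycle c /\ fcycle psi c.
Proof.
rewrite tight_critical_cycle; split=> -[sc H]; split=> //.
  have [_ uc] := sc; apply: cycle_from_next => // i ic /=; apply/eqP.
  by apply: s_strict; apply: (H (i, next c i)); apply: map_f.
by move=> e /mapP[i ic ->] /=; rewrite (nextE H ic).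
Qed.

(** When the zero-slack edges are exactly those of [psi], critical cycles and maximal paths must
    follow [psi], which leaves one choice. *)
Lemma strict_generic : generic A.
Proof.
exists (orbit psi r); split.
- by apply/critical_fcycle; split=> //; apply: root_fcycle.
- move=> c /critical_fcycle[sc fc]; have rc := fcycle_root psir sc fc.
  (* [orbit psi r] is [c] rotated to start at [r]; this offset undoes that rotation. *)
  have [_ uc] := sc; exists (size c - index r c)%N.
  by rewrite (orbitE fc uc rc); have := rotK (index r c) c; rewrite /rotr size_rot.
- move=> i l; rewrite -fconnect_orbit => rl.
  have il := connect_trans (psir i) rl.
  exists (orbit_path psi i l); split.
    apply/(tight_maximal_path _ il); split; first exact: orbit_path_simple.
    move=> e /(proj2 (path_edges_all (frel psi) i _) (fpath_traject _ _ _)).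
    by move=> /= /eqP <-; apply: s_psi.
  move=> p /(tight_maximal_path _ il)[sp p0].
  rewrite -(orbit_path_uniq _ sp) //.
  by apply/path_edges_all => e /p0 /s_strict /= ->.
Qed.

Lemma strict_critical_edge i j : critical_edge A i j <-> psi i = j.
Proof.
split=> [[c /critical_fcycle[sc fc]]|<-].
  case=> [/mapP[k kc [-> ->]]|[v [l [p [vc lc pmax _ ip]]]]].
    by rewrite (nextE fc kc).
  have vl : fconnect psi v l.
    apply: connect_trans (psir v) _.
    by rewrite (fconnect_cycle fc (fcycle_root psir sc fc)).
  by have [_ /(_ _ ip)/s_strict] := (tight_maximal_path p vl).1 pmax.
have fo := root_fcycle psir.
exists (orbit psi r); first by apply/critical_fcycle.
have [ic|ic] := boolP (i \in orbit psi r).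
  by left; apply/mapP; exists i; rewrite ?(nextE fo ic).
(* The maximal path ends at the first vertex [l] where the walk from [i] enters the cycle. By
   minimality of [k] no source of its edges lies on the cycle, so it avoids the cycle edges. *)
right; have exk : exists k, iter k psi i \in orbit psi r.
  by exists (findex psi i r); rewrite iter_findex.
have [k kP kmin] := ex_minnP exk; set l := iter k psi i in kP.
have il : fconnect psi i l by apply: fconnect_iter.
have lk : findex psi i l = k.
  apply/eqP; rewrite eqn_leq kmin ?iter_findex // andbT leqNgt.
  apply/negP => klt; have := findex_max il.
  by move=> /(ltn_trans klt)/findex_iter E; rewrite -/l in E; rewrite E ltnn in klt.
exists i, l, (orbit_path psi i l); split=> //.
- apply/(tight_maximal_path _ il); split; first exact: orbit_path_simple.
  move=> e /(proj2 (path_edges_all (frel psi) i _) (fpath_traject _ _ _)).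
  by move=> /= /eqP <-; apply: s_psi.
- move=> e /path_edges_source; rewrite /orbit_path lk => eb.
  apply/negP => /mapP[j' jc eE]; move: eb; rewrite eE /=.
  have -> m u : belast u (traject psi (psi u) m) = traject psi u m.
    by elim: m u => //= m IH u; rewrite IH.
  by case/trajectP=> m mk jE; move: (kmin m); rewrite -jE jc leqNgt mk => /(_ isT).
- rewrite /orbit_path lk; case: k @l kP kmin il lk => [|k] l.
    by rewrite (negPf ic).
  by rewrite /path_edges /= mem_head.
Qed.

End Strict.
End Tight.

(** * Eigenpairs in terms of slacks, and their uniqueness *)

Section Eigenpairs.
Context {R : realType} {n : nat}.
Implicit Types (A : 'M[R]_n) (x y : 'cV[R]_n) (i j : 'I_n).

Lemma eigenpairP A lam x : eigenpair A lam x <->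
  (forall i j, 0 <= slack A lam (x^~ 0) i j) /\
  (forall i, exists j, slack A lam (x^~ 0) i j = 0).
Proof.
split=> [Ax|[s0 ex0] i].
  have s0 i j : 0 <= slack A lam (x^~ 0) i j.
    have : A i j + x j 0 <= lam + x i 0 by rewrite -Ax le_bigmax.
    rewrite /slack; lra.
  split=> // i; have : lam + x i 0 <= lam + x i 0 by [].
  rewrite -[X in _ <= X]Ax => /bigmax_geP[H|[j _ H]]; [exists i|exists j].
    by move: H (s0 i i); rewrite /slack; lra.
  by move: H (s0 i j); rewrite /slack; lra.
have [j j0] := ex0 i; apply/eqP; rewrite eq_le; apply/andP; split.
  apply/bigmax_leP; split=> [|k _].
    by have := s0 i i; rewrite /slack; lra.
  by have := s0 i k; rewrite /slack; lra.
have -> : lam + x i 0 = A i j + x j 0 by move: j0; rewrite /slack; lra.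
exact: le_bigmax.
Qed.

Lemma tp_eq_slack A lam x y : tp_eq x y ->
  slack A lam (x^~ 0) =2 slack A lam (y^~ 0).
Proof. by case=> c -> i j; rewrite /slack !mxE; ring. Qed.

Lemma tp_eqP x y i0 :
  tp_eq x y <-> forall i, x i 0 - y i 0 = x i0 0 - y i0 0.
Proof.
split=> [[c ->] i|H]; first by rewrite !mxE; ring.
exists (x i0 0 - y i0 0); apply/colP => i; rewrite !mxE -(H i); ring.
Qed.

(* Compare at the index where y - x is maximal. *)
Lemma eigenvalue_le A lam mu x y (i0 : 'I_n) :
  eigenpair A lam x -> eigenpair A mu y -> mu <= lam.
Proof.
move=> /eigenpairP[s0 _] /eigenpairP[_ ex0].
have [i _ imax] := @arg_maxP _ R _ i0 predT (fun i => y i 0 - x i 0) isT.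
have [j] := ex0 i; move: (s0 i j) (imax j isT); rewrite /slack /=; lra.
Qed.

(** A maximum principle for [z = y - x]: it does not increase along [psi], so it is minimal at [r];
    and its maximum is carried along [psi] to [r]. Hence [z] is constant. *)
Lemma strict_unique_eigenpair A lam x (psi : 'I_n -> 'I_n) r :
  (forall i, fconnect psi i r) ->
  (forall i j, 0 <= slack A lam (x^~ 0) i j) ->
  (forall i j, slack A lam (x^~ 0) i j = 0 <-> psi i = j) ->
  unique_eigenpair A lam x.
Proof.
move=> psir s0 sP; have Ax : eigenpair A lam x.
  by apply/eigenpairP; split=> // i; exists (psi i); apply/sP.
split=> // mu y Ay; have {}mul : mu = lam.
  apply/eqP; rewrite eq_le.
  by rewrite (eigenvalue_le r Ax Ay) (eigenvalue_le r Ay Ax).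
rewrite mul in Ay; have /eigenpairP[t0 tex] := Ay; split=> //.
pose z i := y i 0 - x i 0.
have zpsi i : z (psi i) <= z i.
  have := t0 i (psi i); have := (sP i (psi i)).2 erefl; rewrite /slack /z; lra.
have zup i : exists2 j, z i <= z j & slack A lam (x^~ 0) i j = z j - z i.
  have [j j0] := tex i; exists j; move: j0 (s0 i j); rewrite /slack /z; lra.
have [a _ amax] := @arg_maxP _ R _ r predT z isT.
have {}amax i : z i <= z a by apply: amax.
(* At a maximum of [z], an edge tight for [y] is tight for [x] as well, hence is the edge of
   [psi]. *)
have zr : z r = z a.
  apply/eqP; apply: (@fconnect_closed _ psi (fun i => z i == z a) _ _ _ (psir a)).
    move=> i /eqP zi; have [j zij] := zup i.
    have -> : z j = z i by apply/eqP; rewrite eq_le zij zi amax.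
    by rewrite subrr => /sP -> ; rewrite eq_le amax /= -zi.
  exact: eqxx.
apply/(tp_eqP _ _ r) => i; rewrite -/(z i) -/(z r).
apply/eqP; rewrite eq_le zr amax /= -zr.
by rewrite -(iter_findex (psir i)); elim: findex => //= k /(le_trans (zpsi _)).
Qed.

End Eigenpairs.

(** * Linear functionals and neighbourhoods in matrix space *)

Section Topology.
Context {R : realType} {n : nat}.
Implicit Types (A B : 'M[R]_n).

Lemma mx_linear_continuous (l : {linear 'M[R]_n -> R^o}) : continuous l.
Proof.
have -> : l = (fun A => \sum_i \sum_j A i j * l (delta_mx i j)) :> (_ -> _).
  apply/funext => A; rewrite {1}[A]matrix_sum_delta linear_sum.
  apply: eq_bigr => i _; rewrite linear_sum; apply: eq_bigr => j _.
  by rewrite linearZ.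
apply: continuous_big => [|i _]; first exact: add_continuous.
apply: continuous_big => [|j _]; first exact: add_continuous.
move=> A; apply: (@cvgMr_tmp R _ (nbhs A) _ (fun B : 'M[R]_n => B i j)).
exact: (@coord_continuous R n n i j A).
Qed.

Lemma nbhs_line A B (W : set 'M[R]_n) : nbhs A W ->
  exists2 e : R, 0 < e & forall t, `|t| <= e -> W (A + t *: B).
Proof.
move=> /nbhs_ballP[d /= d0 dW].
(* Adding 1 keeps the denominator nonzero when [B] vanishes. *)
have B1 : 0 < `|B| + 1 by rewrite ltr_wpDl.
exists (d / (`|B| + 1)); first exact: divr_gt0.
move=> t; rewrite ler_pdivlMr // => td; apply: dW.
rewrite -ball_normE /= opprD addrA subrr sub0r normrN normrZ.
have [->|t0] := eqVneq t 0; first by rewrite normr0 mul0r.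
apply: lt_le_trans td; rewrite ltr_pM2l ?normr_gt0 // ltrDl //.
Qed.

Lemma near_linear_gt0 (l : {linear 'M[R]_n -> R^o}) A :
  0 < l A -> \forall B \near A, 0 < l B.
Proof.
move=> lA; have := @mx_linear_continuous l A; move/(_ [set y | 0 < y]); apply.
exact: (@lt_nbhsr R 0 (l A)).
Qed.

Lemma near_linear_neq0 (l : {linear 'M[R]_n -> R^o}) A :
  l A != 0 -> \forall B \near A, l B != 0.
Proof.
rewrite neq_lt => /orP[lA|/near_linear_gt0 H]; last first.
  by apply: filterS H => B; rewrite neq_lt orbC => ->.
have := @mx_linear_continuous l A; move/(_ [set y | y != 0]); apply.
have : \forall y \near (l A : R), y < 0 by exact: (@lt_nbhsl R (l A) 0).
by apply: filterS => y /=; rewrite neq_lt => ->.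
Qed.

Lemma closure_linear_ge0 (l : {linear 'M[R]_n -> R^o}) (S : set 'M[R]_n) A :
  (forall B, S B -> 0 <= l B) -> closure S A -> 0 <= l A.
Proof.
move=> Sl clA; rewrite leNgt; apply/negP => lA.
have : \forall B \near A, l B < 0.
  have := @mx_linear_continuous l A; move/(_ [set y | y < 0]); apply.
  exact: (@lt_nbhsl R (l A) 0).
by move=> /clA[B [/Sl + /=]]; rewrite leNgt => /negP.
Qed.

End Topology.

Lemma skew_symmetricP (R : realType) (n : nat) (a : R) (A B : 'M[R]_n) :
  skew_symmetric R n A -> skew_symmetric R n B ->
  skew_symmetric R n (A + a *: B).
Proof.
by move=> sA sB i j; rewrite !mxE addrACA sA -mulrDr sB mulr0 addr0.
Qed.

(** * The linear eigenpair map of a function and the cone of a kite *)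

Section Eigenmap.
Context {R : realType} {n : nat}.
Variables (phi : {ffun 'I_n -> 'I_n}) (r : 'I_n).
Implicit Types (A B : 'M[R]_n) (i j : 'I_n) (x : 'I_n -> R).

Definition walk_sum A i k : R := \sum_(t < k) A (iter t phi i) (iter t.+1 phi i).

(* The mean weight of the cycle of phi through r. *)
Definition eigval A : R^o :=
  walk_sum A r (findex phi (phi r) r).+1 / (findex phi (phi r) r).+1%:R.

(** The solution of the equations [s_(i, phi i) = 0], normalised to vanish at [r]. The codomain
    [R^o] allows a structure of linear functional. *)
Definition potential i A : R^o :=
  walk_sum A i (findex phi i r) - (findex phi i r)%:R * eigval A.

Definition reduced i j A : R^o := slack A (eigval A) (potential^~ A) i j.

Definition eigenmap A : R * 'cV[R]_n := (eigval A, \col_i potential i A).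

Lemma walk_sum_linear (a : R) A B i k :
  walk_sum (a *: A + B) i k = a * walk_sum A i k + walk_sum B i k.
Proof.
by rewrite mulr_sumr -big_split; apply: eq_bigr => t _; rewrite !mxE.
Qed.

Lemma walk_sumS A i k :
  walk_sum A i k.+1 = A i (phi i) + walk_sum A (phi i) k.
Proof.
rewrite /walk_sum big_ord_recl; congr (_ + _); apply: eq_bigr => t _.
by rewrite -!iterSr.
Qed.

Lemma eigval_linear : linear eigval.
Proof.
by move=> a A B; rewrite /eigval walk_sum_linear mulrDl -mulrA.
Qed.

HB.instance Definition _ :=
  GRing.isLinear.Build R 'M[R]_n R^o *:%R eigval eigval_linear.

Lemma potential_linear i : linear (potential i).
Proof.
move=> a A B; rewrite -[RHS]/(a * potential i A + potential i B) /potential.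
by rewrite walk_sum_linear (eigval_linear a A B : _ = a * _ + _); ring.
Qed.

HB.instance Definition _ i :=
  GRing.isLinear.Build R 'M[R]_n R^o *:%R (potential i) (potential_linear i).

Lemma reduced_linear i j : linear (reduced i j).
Proof.
move=> a A B; rewrite -[RHS]/(a * reduced i j A + reduced i j B) /reduced /slack.
rewrite !mxE (eigval_linear a A B : _ = a * _ + _).
by rewrite !(potential_linear _ a A B : _ = a * _ + _); ring.
Qed.

HB.instance Definition _ i j :=
  GRing.isLinear.Build R 'M[R]_n R^o *:%R (reduced i j) (reduced_linear i j).

Lemma reduced_slack A i j :
  reduced i j A = slack A (eigenmap A).1 ((eigenmap A).2^~ 0) i j.
Proof. by rewrite /reduced /slack !mxE. Qed.

Lemma eigenmap_linear : skew_linear eigenmap.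
Proof.
move=> a A B _ _; split; first exact: eigval_linear.
exists 0; apply/colP => i; rewrite !mxE potential_linear addr0; done.
Qed.

Lemma potential_root A : potential r A = 0.
Proof. by rewrite /potential findex0 /walk_sum big_ord0 mul0r subr0. Qed.

Hypothesis phir : forall i, fconnect phi i r.

(** Away from [r] this is the recursion of the walk sums; at [r] it closes the cycle and holds
    because [eigval] is the cycle mean. *)
Lemma reduced_phi A i : reduced i (phi i) A = 0.
Proof.
rewrite /reduced /slack; have [->|ir] := eqVneq i r.
  rewrite potential_root /potential /eigval walk_sumS.
  set k := findex phi (phi r) r; have : k.+1%:R != 0 :> R by rewrite pnatr_eq0.
  by rewrite -natr1 => k0; field.
rewrite /potential (fconnect_findex (phir i)) 1?eq_sym // walk_sumS -natr1; ring.
Qed.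

Lemma walk_sum_slack A lam x i k :
  (forall i, slack A lam x i (phi i) = 0) ->
  walk_sum A i k = k%:R * lam + x i - x (iter k phi i).
Proof.
move=> s0; elim: k i => [|k IH] i.
  by rewrite /walk_sum big_ord0 mul0r /= add0r subrr.
rewrite walk_sumS IH -iterSr -natr1; have := s0 i; rewrite /slack => E.
have -> : A i (phi i) = lam + x i - x (phi i) by move: E; lra.
ring.
Qed.

Section Evaluation.
Variables (A : 'M[R]_n) (lam : R) (x : 'I_n -> R).
Hypothesis s0 : forall i, slack A lam x i (phi i) = 0.

(** Telescoping around the cycle eliminates [x]. Hence any solution of the zero-slack equations
    along [phi] may be used to compute [eigval], [potential] and [reduced]. *)
Lemma eigvalE : eigval A = lam.
Proof.
rewrite /eigval (walk_sum_slack _ _ s0) iterSr iter_findex // addrK.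
by rewrite mulrAC mulfV ?mul1r // pnatr_eq0.
Qed.

Lemma potentialE i : potential i A = x i - x r.
Proof.
rewrite /potential eigvalE (walk_sum_slack _ _ s0) iter_findex //; ring.
Qed.

Lemma reducedE i j : reduced i j A = slack A lam x i j.
Proof. by rewrite /reduced /slack eigvalE !potentialE; ring. Qed.

End Evaluation.

Lemma reduced_skew A i j : skew_symmetric R n A ->
  reduced i j A + reduced j i A = 2 * eigval A.
Proof. by move=> /(_ i j); rewrite /reduced /slack; lra. Qed.

Lemma reduced_diag A i : skew_symmetric R n A -> reduced i i A = eigval A.
Proof. by move=> /(_ i i); rewrite /reduced /slack; lra. Qed.

Lemma strict_eigenmap A : (forall i j, phi i != j -> 0 < reduced i j A) ->
  unique_eigenpair A (eigenmap A).1 (eigenmap A).2.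
Proof.
move=> strict; apply: (strict_unique_eigenpair phir) => i j.
  rewrite -reduced_slack; have [<-|/strict/ltW//] := eqVneq (phi i) j.
  by rewrite reduced_phi.
rewrite -reduced_slack; split=> [|<-]; last exact: reduced_phi.
by have [//|/strict/lt0r_neq0/eqP] := eqVneq (phi i) j.
Qed.

Lemma strict_critical A : (forall i j, phi i != j -> 0 < reduced i j A) ->
  generic A /\ critical_graph A phi.
Proof.
move=> strict; have s0 i j : 0 <= slack A (eigval A) (potential^~ A) i j.
  have [<-|/strict/ltW//] := eqVneq (phi i) j.
  by rewrite -/(reduced _ _ _) reduced_phi.
have sphi i : slack A (eigval A) (potential^~ A) i (phi i) = 0.
  exact: reduced_phi.
have sP i j : slack A (eigval A) (potential^~ A) i j = 0 -> phi i = j.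
  by have [//|/strict/lt0r_neq0/eqP] := eqVneq (phi i) j.
split; first exact: (strict_generic s0 sphi phir sP).
by move=> i j; apply: (strict_critical_edge s0 sphi phir sP).
Qed.

(** A pair with nonnegative slacks exists, and its slacks vanish on critical edges; so its slacks
    are those of the pair determined by [phi]. *)
Lemma critical_reduced_ge0 A i j : generic A -> critical_graph A phi ->
  0 <= reduced i j A.
Proof.
move=> gA cA; have [lam [x [r' [s0 [psi [spsi psir]]]]]] := nonneg_slack_root A r.
rewrite (reducedE (lam := lam) (x := x)) // => k.
by apply: (critical_graph_slack s0 spsi psir gA); apply/cA.
Qed.

(** A point interior to the cone: with eigenvalue 1 and zero potential, its slacks are 0 on edges of
    the kite, 2 on reversed edges and 1 elsewhere. *)
Definition kite_center : 'M[R]_n :=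
  \matrix_(i, j) ((phi i == j)%:R - (phi j == i)%:R).

Hypothesis phi2 : forall i, phi (phi i) != i.

Lemma kite_center_skew : skew_symmetric R n kite_center.
Proof. by move=> i j; rewrite !mxE; ring. Qed.

Lemma slack_center i : slack kite_center 1 (fun=> 0) i (phi i) = 0.
Proof. by rewrite /slack mxE eqxx (negPf (phi2 i)) /=; ring. Qed.

Lemma reduced_center i j :
  reduced i j kite_center = 1 - (phi i == j)%:R + (phi j == i)%:R.
Proof. by rewrite (reducedE slack_center) /slack mxE; ring. Qed.

Lemma reduced_center_gt0 i j : phi i != j -> 0 < reduced i j kite_center.
Proof.
by move=> /negPf ij; rewrite reduced_center ij; case: eqP => _ /=; lra.
Qed.

(** Weak inequalities pass to the closure. Conversely, adding a small multiple of [kite_center]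
    makes the inequalities strict, and then the matrix is generic with critical graph [phi]. *)
Lemma Omega_kite : Omega phi = [set A | forall i j, 0 <= reduced i j A].
Proof.
apply/seteqP; split=> A.
  move=> clA i j; apply: closure_linear_ge0 clA => B [gB cB].
  exact: critical_reduced_ge0.
move=> A0 W /(@nbhs_line _ _ A kite_center)[e e0 eW].
exists (A + e *: kite_center); split; last by apply: eW; rewrite gtr0_norm.
apply: strict_critical => i j ij; rewrite linearD linearZ /=.
by rewrite ltr_wpDl ?A0 // mulr_gt0 ?reduced_center_gt0.
Qed.

Lemma skew_coneE A : skew_cone R phi A <->
  skew_symmetric R n A /\ forall i j, 0 <= reduced i j A.
Proof. by rewrite /skew_cone Omega_kite; split=> -[]. Qed.

Lemma near_reduced_gt0 (Q : rel 'I_n) A :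
  (forall i j, Q i j -> 0 < reduced i j A) ->
  \forall B \near A, forall i j, Q i j -> 0 < reduced i j B.
Proof.
move=> QA; apply: (@filter_forall _ _
  (fun i B => forall j, Q i j -> 0 < reduced i j B) (nbhs A) _) => i.
apply: (@filter_forall _ _ (fun j B => Q i j -> 0 < reduced i j B)
  (nbhs A) _) => j.
have [/QA/near_linear_gt0 nA|_] := boolP (Q i j); last exact: filterE.
exact: filterS nA.
Qed.

Lemma reduced_gt0_line (Q : rel 'I_n) A B :
  (forall i j, Q i j -> 0 < reduced i j A) ->
  exists2 e : R, 0 < e & forall t, `|t| <= e ->
    forall i j, Q i j -> 0 < reduced i j (A + t *: B).
Proof. by move/near_reduced_gt0 => /(@nbhs_line _ _ A B). Qed.

Lemma strict_skew_cone A : skew_symmetric R n A ->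
  (forall i j, phi i != j -> 0 < reduced i j A) -> skew_cone R phi A.
Proof.
move=> sA strict; apply/skew_coneE; split=> // i j.
by have [<-|/strict/ltW//] := eqVneq (phi i) j; rewrite reduced_phi.
Qed.

Lemma affine_hull_skew A :
  affine_hull (skew_cone R phi) A <-> skew_symmetric R n A.
Proof.
split=> [[k [c [p [pC _ ->]]]] i j|sA].
  rewrite !summxE -big_split big1 // => t _ /=; rewrite !mxE -mulrDr.
  by have [sp _] := (skew_coneE _).1 (pC t); rewrite sp mulr0.
have [e e0 eC] :=
  reduced_gt0_line (Q := fun i j => phi i != j) A reduced_center_gt0.
(* [A] is the difference of two points near the centre, divided by [e]; the third point 0 brings the
   sum of the coefficients to 1. *)
exists 3%N, (tnth [tuple e^-1; - e^-1; 1]).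
exists (tnth [tuple kite_center + e *: A; kite_center; 0]); split.
- case=> -[|[|[|//]]] k; rewrite (tnth_nth 0) /=.
  + apply: strict_skew_cone; last by apply: eC; rewrite gtr0_norm.
    by apply: skew_symmetricP; [apply: kite_center_skew|].
  + apply: strict_skew_cone; [exact: kite_center_skew|exact: reduced_center_gt0].
  + by apply/skew_coneE; split=> [i j|i j]; rewrite ?linear0 // !mxE addr0.
- by rewrite !big_ord_recl big_ord0 !(tnth_nth 0) /=; ring.
- rewrite !big_ord_recl big_ord0 !(tnth_nth 0) /= scalerDr scalerA.
  rewrite mulVf ?gt_eqF //.
  by rewrite scale1r scaler0 !addr0 scaleNr addrAC subrr add0r.
Qed.

Lemma relint_skew_cone A : relint (skew_cone R phi) A <->
  skew_symmetric R n A /\ forall i j, phi i != j -> 0 < reduced i j A.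
Proof.
split=> [[/skew_coneE[sA A0] nearA]|[sA strict]]; last first.
  split; first exact: strict_skew_cone.
  apply: filterS (near_reduced_gt0 (Q := fun i j => phi i != j) strict).
  move=> B sB /affine_hull_skew.
  by move/strict_skew_cone; apply.
(* A relatively interior point may move away from the centre and stay in the cone, so its slack is
   at least [e] times that of the centre. *)
split=> // i j ij; have [e e0 eC] := nbhs_line kite_center nearA.
have := eC (- e); rewrite normrN gtr0_norm // lexx => /(_ isT).
have /affine_hull_skew sB : skew_symmetric R n (A + (- e) *: kite_center).
  by apply: skew_symmetricP => //; apply: kite_center_skew.
move=> /(_ sB)/skew_coneE[_ /(_ i j)].
rewrite linearD linearZ /= /GRing.scale /= mulNr subr_ge0; apply: lt_le_trans.
by rewrite mulr_gt0 ?reduced_center_gt0.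
Qed.

End Eigenmap.

(** * Maximal cones of linearity are the interiors of kite cones *)

Section LinearityCones.
Context {R : realType} {n : nat}.
Implicit Types (A B : 'M[R]_n) (phi : {ffun 'I_n -> 'I_n}) (r i j : 'I_n).

Lemma unique_eigenpair_eq A lam mu (x y : 'cV[R]_n) :
  unique_eigenpair A lam x -> unique_eigenpair A mu y ->
  lam = mu /\ tp_eq x y.
Proof. by move=> [Ax _] [_]; apply. Qed.

Lemma relint_representation phi r :
  (forall i, fconnect phi i r) -> (forall i, phi (phi i) != i) ->
  linear_representation (relint (skew_cone R phi)) (eigenmap phi r).
Proof.
move=> phir phi2; split; first exact: eigenmap_linear.
by move=> A /(relint_skew_cone phir phi2)[_]; apply: strict_eigenmap.
Qed.

(** Uniqueness of the eigenpair makes the two maps agree at [A] and at [A + t B] for small [t];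
    linearity then gives agreement at [B]. *)
Lemma representation_eigenmap phi r (U : set 'M[R]_n) f A :
  (forall i, fconnect phi i r) ->
  open_in_skew U -> linear_representation U f ->
  U A -> (forall i j, phi i != j -> 0 < reduced phi r i j A) ->
  skew_map_eq f (eigenmap phi r).
Proof.
move=> phir [W oW UE] [flin fU] UA strict B sB.
have [WA sA] : (W `&` skew_symmetric R n) A by rewrite -UE.
have [d d0 dW] := nbhs_line B (open_nbhs_nbhs (conj oW WA)).
have [e e0 eS] := reduced_gt0_line (Q := fun i j => phi i != j) B strict.
pose t := Num.min d e; have t0 : 0 < t by rewrite lt_min d0 e0.
have tn : `|t| = t by rewrite gtr0_norm.
have te : `|t| <= e by rewrite tn ge_min lexx orbT.
have UAt : U (A + t *: B).
  by rewrite UE; split; [apply: dW; rewrite tn ge_min lexx|apply: skew_symmetricP].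
have [val_t tp_t] :=
  unique_eigenpair_eq (fU _ UAt) (strict_eigenmap phir (eS t te)).
have [val_0 tp_0] := unique_eigenpair_eq (fU A UA) (strict_eigenmap phir strict).
move: val_t tp_t; rewrite addrC; have [-> tpf] := flin t B A sB sA.
have [-> tpe] := eigenmap_linear phi r t sB sA.
rewrite val_0 => /addIr/(mulfI (lt0r_neq0 t0)) -> tp_t; split=> //.
move/(tp_eqP _ _ r): tp_t => tp_t; apply/(tp_eqP _ _ r) => i.
move: (tp_t i); move/(tp_eqP _ _ r)/(_ i): tpf; move/(tp_eqP _ _ r)/(_ i): tpe.
move/(tp_eqP _ _ r)/(_ i): tp_0; rewrite !mxE => e1 e2 e3 e4.
apply: (mulfI (lt0r_neq0 t0)); move: e1 e2 e3 e4; rewrite !mulrBr; lra.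
Qed.

Lemma relint_strict phi r A :
  (forall i, fconnect phi i r) -> (forall i, phi (phi i) != i) ->
  relint (skew_cone R phi) A ->
  forall i j, reduced phi r i j A = 0 <-> phi i = j.
Proof.
move=> phir phi2 /(relint_skew_cone phir phi2)[_ strict] i j.
split=> [|<-]; last exact: reduced_phi.
by have [//|/strict/lt0r_neq0/eqP] := eqVneq (phi i) j.
Qed.

Lemma relint_center phi r :
  (forall i, fconnect phi i r) -> (forall i, phi (phi i) != i) ->
  relint (skew_cone R phi) (kite_center phi).
Proof.
move=> phir phi2; apply/(relint_skew_cone phir phi2); split.
  exact: kite_center_skew.
exact: reduced_center_gt0.
Qed.

Lemma open_in_skew_relint phi : kite phi -> open_in_skew (relint (skew_cone R phi)).
Proof.
case/kiteP=> r [phir phi2].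
exists [set A | forall i j, phi i != j -> 0 < reduced phi r i j A].
  by rewrite openE => A; apply: (@near_reduced_gt0 _ _ _ _ (fun i j => phi i != j)).
by apply/seteqP; split=> A; rewrite (relint_skew_cone phir phi2) => -[].
Qed.

(** At the centre of [phi] the zero slacks are exactly the edges of [phi], whereas the map of [psi]
    makes every slack along [psi] vanish. *)
Lemma kite_linear_eq phi psi f g : kite phi -> kite psi ->
  linear_representation (relint (skew_cone R phi)) f ->
  linear_representation (relint (skew_cone R psi)) g ->
  skew_map_eq f g -> phi = psi.
Proof.
move=> kphi kpsi fphi gpsi fg.
have ophi := open_in_skew_relint kphi; have opsi := open_in_skew_relint kpsi.
have [r [phir phi2]] := (kiteP _).1 kphi; have [q [psiq psi2]] := (kiteP _).1 kpsi.
have cphi := relint_center phir phi2; have cpsi := relint_center psiq psi2.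
have [sc strict] := (relint_skew_cone phir phi2 _).1 cphi.
have [_ strict'] := (relint_skew_cone psiq psi2 _).1 cpsi.
have [f1 f2] := representation_eigenmap phir ophi fphi cphi strict sc.
have [g1 g2] := representation_eigenmap psiq opsi gpsi cpsi strict' sc.
have [h1 h2] := fg _ sc; apply/ffunP => i.
apply/(relint_strict phir phi2 cphi); rewrite reduced_slack -f1 h1 g1.
rewrite -(tp_eq_slack _ _ f2) (tp_eq_slack _ _ h2) (tp_eq_slack _ _ g2).
by rewrite -reduced_slack reduced_phi.
Qed.

Lemma linearity_cone_relint phi :
  kite phi -> linearity_cone (relint (skew_cone R phi)).
Proof.
move=> kphi; have [r [phir phi2]] := (kiteP _).1 kphi; split.
- by exists (kite_center phi); apply: relint_center phi2.
- exact: open_in_skew_relint.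
- split=> [a A a0|A B]; rewrite !(relint_skew_cone phir phi2).
    move=> [sA strict]; split=> [i j|i j ij].
      by rewrite !mxE -mulrDr sA mulr0.
    by rewrite linearZ /= mulr_gt0 ?strict.
  move=> [sA sA'] [sB sB']; split=> [i j|i j ij].
    by rewrite !mxE addrACA sA sB addr0.
  by rewrite linearD addr_gt0 ?sA' ?sB'.
- by exists (eigenmap phi r); apply: relint_representation.
Qed.

(** Perturb off one hyperplane at a time, shrinking [W] so that the later perturbations stay off the
    earlier ones. *)
Lemma avoid_hyperplanes (I : eqType) (l : I -> {linear 'M[R]_n -> R^o})
    (P : pred I) (s : seq I) (W : set 'M[R]_n) A :
  (forall k, P k -> exists2 B, skew_symmetric R n B & l k B != 0) ->
  open W -> W A -> skew_symmetric R n A ->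
  exists B, [/\ W B, skew_symmetric R n B &
    forall k, k \in s -> P k -> l k B != 0].
Proof.
move=> lP; elim: s W A => [|k s IH] W A oW WA sA; first by exists A.
have [Pk|nPk] := boolP (P k); last first.
  have [B [WB sB Bs]] := IH W A oW WA sA; exists B; split=> // m.
  by rewrite inE => /predU1P[->|/Bs//]; rewrite (negPf nPk).
have [A' [WA' sA' lA']] : exists B, [/\ W B, skew_symmetric R n B & l k B != 0].
  have [lA|lA] := eqVneq (l k A) 0; last by exists A.
  have [B sB lB] := lP k Pk.
  have [e e0 eW] := nbhs_line B (open_nbhs_nbhs (conj oW WA)).
  exists (A + e *: B); split; [|exact: skew_symmetricP|].
    by apply: eW; rewrite gtr0_norm.
  by rewrite linearD lA add0r linearZ /= scaler_eq0 negb_or lt0r_neq0.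
have [||//|B [[WB lB] sB Bs]] := IH (W `&` [set B | l k B != 0]) A'.
- by apply: openI => //; rewrite openE => B; apply: near_linear_neq0.
- by [].
by exists B; split=> // m; rewrite inE => /predU1P[->//|]; apply: Bs.
Qed.

(** It vanishes on all matrices [x_i - x_j], so a nonzero value excludes eigenvalue 0 for
    skew-symmetric matrices. *)
Definition triangle (a b c : 'I_n) A : R^o := A a b + A b c + A c a.

Lemma triangle_linear a b c : linear (triangle a b c).
Proof.
move=> t A B; rewrite /triangle !mxE -[t *: _]/(t * (_ + _ + _)); ring.
Qed.

HB.instance Definition _ a b c :=
  GRing.isLinear.Build R 'M[R]_n R^o *:%R (triangle a b c)
    (triangle_linear a b c).

Lemma skew_kite_exists A a b c : skew_symmetric R n A ->
  triangle a b c A != 0 ->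
  exists phi r, [/\ forall i, fconnect phi i r, forall i, phi (phi i) != i &
    forall i j, 0 <= reduced phi r i j A].
Proof.
move=> sA tA; have [lam [x [r [s0 [psi [spsi psir]]]]]] := nonneg_slack_root A a.
pose phi := [ffun i => psi i]; exists phi, r.
have phir i : fconnect phi i r.
  by rewrite (eq_fconnect (f' := psi)) // => j; rewrite ffunE.
split=> // [i|i j]; last first.
  by rewrite (reducedE phir (lam := lam) (x := x)) // => k; rewrite ffunE.
apply: contraNneq tA; rewrite !ffunE => psi2.
(* A cycle of length at most 2 has mean 0. Then opposite slacks are nonnegative with sum 0, so all
   slacks vanish. *)
have lam0 : lam = 0.
  have := spsi (psi i); have := spsi i; have := sA i (psi i).
  by rewrite psi2 /slack; lra.
have AE u v : A u v = x u - x v.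
  by move: (s0 u v) (s0 v u) (sA u v); rewrite /slack lam0; lra.
by rewrite /triangle !AE; apply/eqP; ring.
Qed.

(** A point of [U] off all relevant hyperplanes is interior to the cone of some kite. There [f] is
    the eigenmap of that kite, hence everywhere, and eigenpairs have nonnegative slacks on all of
    [U]. *)
Lemma linearity_cone_sub (U : set 'M[R]_n) : (3 <= n)%N -> linearity_cone U ->
  exists2 phi, kite phi & U `<=` relint (skew_cone R phi).
Proof.
move=> n3 [[A0 UA0] oU _ [f fU]]; have [W oW UE] := oU.
have [WA0 sA0] : (W `&` skew_symmetric R n) A0 by rewrite -UE.
pose o k (kn : (k < 3)%N) : 'I_n := Ordinal (leq_trans kn n3).
pose T := @triangle (@o 0 isT) (@o 1 isT) (@o 2 isT).
(* [None] indexes the triangle functional and [Some] the slacks; [P] selects those slacks that come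
   from a rooted kite and not from one of its edges. *)
pose I : eqType := option ({ffun 'I_n -> 'I_n} * 'I_n * ('I_n * 'I_n)).
pose l (k : I) : {linear 'M[R]_n -> R^o} :=
  if k is Some (phi, r, (i, j)) then reduced phi r i j else T.
pose P (k : I) := if k is Some (phi, r, (i, j)) then
  [&& [forall u, fconnect phi u r], [forall u, phi (phi u) != u] & phi i != j]
  else true.
have [[[[phi r] [i j]]|] /=|A [WA sA lA]] :=
    @avoid_hyperplanes _ l P (enum [set: option _]) W A0 _ oW WA0 sA0.
- case/and3P=> /forallP phir /forallP phi2 ij; exists (kite_center phi).
    exact: kite_center_skew.
  by rewrite gt_eqF ?reduced_center_gt0.
- move=> _; exists (delta_mx (@o 0 isT) (@o 1 isT) - delta_mx (@o 1 isT) (@o 0 isT)).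
    by move=> i j; rewrite !mxE ![(j == _) && _]andbC; ring.
  by rewrite /T /triangle !mxE /=; apply/eqP; lra.
have {}lA k : P k -> l k A != 0 by apply: lA; rewrite mem_enum inE.
have [phi [r [phir phi2 A_ge0]]] := skew_kite_exists sA (lA None isT).
have strict i j : phi i != j -> 0 < reduced phi r i j A.
  move=> ij; rewrite lt0r A_ge0 andbT; apply: (lA (Some (phi, r, (i, j)))).
  by apply/and3P; split=> //; apply/forallP.
have UA : U A by rewrite UE.
have fE := representation_eigenmap phir oU fU UA strict.
have kphi : kite phi by apply/kiteP; exists r.
have UC : U `<=` skew_cone R phi.
  move=> B UB; have [_ sB] : (W `&` skew_symmetric R n) B by rewrite -UE.
  apply/(skew_coneE phir phi2); split=> // i j.
  have [_ fUB] := fU; have [/eigenpairP[+ _] _] := fUB _ UB.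
  have [f1 f2] := fE _ sB; move/(_ i j).
  by rewrite f1 (tp_eq_slack _ _ f2) -reduced_slack.
exists phi => // B UB; split; first exact: UC.
have [WB _] : (W `&` skew_symmetric R n) B by rewrite -UE.
apply: filterS (open_nbhs_nbhs (conj oW WB)) => C WC.
by move/(affine_hull_skew phir phi2) => sC; apply: UC; rewrite UE.
Qed.

Lemma maximal_linearity_coneP (U : set 'M[R]_n) : (3 <= n)%N ->
  maximal_linearity_cone U <->
  exists2 phi, kite phi & U = relint (skew_cone R phi).
Proof.
move=> n3; split=> [[lU Umax]|[phi kphi ->]].
  have [phi kphi Uphi] := linearity_cone_sub n3 lU; exists phi => //.
  by rewrite (Umax _ (linearity_cone_relint kphi)).
split=> [|U' lU' sub]; first exact: linearity_cone_relint.
have [psi kpsi U'psi] := linearity_cone_sub n3 lU'.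
suff phipsi : phi = psi by apply/seteqP; split=> //; rewrite phipsi.
have [q [psiq psi2]] := (kiteP _).1 kpsi.
have [psilin psiU] := relint_representation psiq psi2.
(* Since [relint (skew_cone R phi)] lies in [U'] and [U'] in the interior for [psi], the map of
   [psi] represents eigenpairs on both interiors. *)
have rep : linear_representation (relint (skew_cone R phi)) (eigenmap psi q).
  by split=> // A /sub/U'psi; apply: psiU.
apply: kite_linear_eq kphi kpsi rep (relint_representation psiq psi2) _.
by move=> A _; split=> //; exists 0; rewrite raddf0 addr0.
Qed.

Lemma relint_unique_representation phi : kite phi ->
  exists2 f, linear_representation (relint (skew_cone R phi)) f &
    forall g, linear_representation (relint (skew_cone R phi)) g ->
      skew_map_eq g f.
Proof.
move=> kphi; have [r [phir phi2]] := (kiteP _).1 kphi.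
exists (eigenmap phi r) => [|g gU]; first exact: relint_representation.
have cphi := relint_center phir phi2.
apply: (representation_eigenmap phir (open_in_skew_relint kphi) gU cphi).
by case/(relint_skew_cone phir phi2): cphi.
Qed.

End LinearityCones.

(** * Counting the pairs with free slack *)

Section FreePairs.
Variables (n : nat) (phi : {ffun 'I_n -> 'I_n}).

(* The ordered pairs whose slack is not forced by membership in the cone. *)
Definition free_pairs : {set 'I_n * 'I_n} :=
  [set p | [&& p.1 != p.2, phi p.1 != p.2 & phi p.2 != p.1]].

Definition upper_free_pairs : {set 'I_n * 'I_n} :=
  [set p in free_pairs | (p.1 < p.2)%N].

Lemma free_pairs_swap i j : ((i, j) \in free_pairs) = ((j, i) \in free_pairs).
Proof.
by rewrite !inE /= [i == j]eq_sym [in RHS]andbCA andbA andbAC -andbA andbCA.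
Qed.

Lemma pair_cases i j :
  [\/ i = j, phi i = j, phi j = i | (i, j) \in free_pairs].
Proof.
rewrite inE /=; have [|_] := eqVneq i j; first by constructor 1.
have [|_] := eqVneq (phi i) j; first by constructor 2.
by have [|_] := eqVneq (phi j) i; [constructor 3|constructor 4].
Qed.

Lemma upper_free_cases i j : (i, j) \in free_pairs ->
  (i, j) \in upper_free_pairs \/ (j, i) \in upper_free_pairs.
Proof.
move=> ij; have := ij; rewrite inE => /and3P[/= ne _ _].
have [lt|gt|/val_inj E] := ltngtP i j; last by rewrite E eqxx in ne.
  by left; rewrite inE ij.
by right; rewrite inE -free_pairs_swap ij.
Qed.

Hypothesis phi2 : forall i, phi (phi i) != i.

Let phiN i : phi i != i.
Proof. by apply: contraNneq (phi2 i) => ii; rewrite !ii. Qed.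

(** The complement is the disjoint union of the diagonal, the graph of [phi] and its reverse, each
    of size [n]; the absence of fixed points and 2-cycles gives disjointness. *)
Lemma card_free_pairs : #|free_pairs| = (n * (n - 3))%N.
Proof.
pose D := [set (i, i) | i : 'I_n]; pose G := [set (i, phi i) | i : 'I_n].
pose G' := [set (phi i, i) | i : 'I_n].
have cD : #|D| = n by rewrite card_imset ?card_ord // => i j [].
have cG : #|G| = n by rewrite card_imset ?card_ord // => i j [].
have cG' : #|G'| = n by rewrite card_imset ?card_ord // => i j [].
have cC : #|~: free_pairs| = (n + n + n)%N.
  have -> : ~: free_pairs = D :|: G :|: G'.
    apply/setP => -[i j]; rewrite !inE /= !negb_and !negbK -orbA.
    congr [|| _, _ | _]; apply/eqP/imsetP => [|[k _ [-> ->]]] //.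
    - by move=> ->; exists j.
    - by move=> <-; exists i.
    - by move=> <-; exists j.
  rewrite !cardsU cD cG cG'.
  have -> : D :&: G = finset.set0.
    apply/setP => p; rewrite !inE; apply/negP => /andP[/imsetP[i _ ->]].
    by case/imsetP=> j _ [->] E; have := phiN j; rewrite -E eqxx.
  have -> : (D :|: G) :&: G' = finset.set0.
    apply/setP => p; rewrite !inE; apply/negP => /andP[pD /imsetP[i _ pE]].
    move: pD; rewrite pE; case/orP=> /imsetP[j _ [E1 E2]].
      by have := phiN i; rewrite E1 -E2 eqxx.
    by have := phi2 i; rewrite E1 -E2 eqxx.
  by rewrite cards0 !subn0.
have := cardsC free_pairs; rewrite cC card_prod !card_ord.
by move: #|free_pairs| => F; rewrite mulnBr; lia.
Qed.

Lemma card_upper_free_pairs : #|upper_free_pairs| = (n * (n - 3) %/ 2)%N.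
Proof.
rewrite -card_free_pairs.
rewrite -(cardsID [set p : 'I_n * 'I_n | (p.1 < p.2)%N] free_pairs).
have -> : free_pairs :&: [set p : 'I_n * 'I_n | (p.1 < p.2)%N] = upper_free_pairs.
  by apply/setP => p; rewrite !inE.
have -> : free_pairs :\: [set p : 'I_n * 'I_n | (p.1 < p.2)%N] =
          [set (p.2, p.1) | p in upper_free_pairs]%SET.
  apply/setP => -[i j]; rewrite finset.in_setD inE /=; apply/andP/imsetP.
    rewrite -leqNgt => -[ji ij]; exists (j, i) => //.
    rewrite inE free_pairs_swap ij /= ltn_neqAle ji andbT eq_sym.
    by move: ij; rewrite inE => /and3P[].
  case=> -[j' i'] /[swap] [[-> ->]] /=; rewrite inE /= => /andP[ij lt].
  by rewrite -leqNgt free_pairs_swap ij ltnW.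
rewrite card_imset; last by move=> [? ?] [? ?] [-> ->].
by rewrite addnn -muln2 mulnK.
Qed.

End FreePairs.

Lemma set_enumeration (T : finType) (S : {set T}) k : #|S| = k ->
  exists e : 'I_k -> T, injective e /\ forall y, y \in S <-> exists i, e i = y.
Proof.
move=> <-; exists enum_val; split; first exact: enum_val_inj.
move=> y; split=> [yS|[i <-]]; last exact: enum_valP.
by exists (enum_rank_in yS y); rewrite enum_rankK_in.
Qed.

(** * Linear coordinates identifying the cone with a space times a cone over a cube *)

Section Coordinates.
Context {R : realType} {n : nat}.
Variables (phi : {ffun 'I_n -> 'I_n}) (r : 'I_n).
Hypothesis phir : forall i, fconnect phi i r.
Hypothesis phi2 : forall i, phi (phi i) != i.
Implicit Types (A B : 'M[R]_n) (i j : 'I_n).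
Let red := @reduced R n phi r.
Let lam := @eigval R n phi r.
Let pot := @potential R n phi r.

(** For a free pair [p], moving in this direction fixes the eigenpair and changes only the slacks of
    [p] and its reverse. *)
Definition skew_delta (p : 'I_n * 'I_n) : 'M[R]_n :=
  \matrix_(i, j) (((i, j) == p)%:R - ((j, i) == p)%:R).

Lemma skew_delta_skew p : skew_symmetric R n (skew_delta p).
Proof. by move=> i j; rewrite !mxE; ring. Qed.

Lemma skew_delta_phi p i : p \in free_pairs phi -> skew_delta p i (phi i) = 0.
Proof.
case: p => a b; rewrite inE mxE /= !xpair_eqE => /and3P[ab pab pba].
have [ia|_] /= := eqVneq i a; first subst i.
  by rewrite (negPf pab) (negPf ab) andbF subrr.
have [ib|_] /= := eqVneq i b; last by rewrite andbF subrr.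
by subst i; rewrite (negPf pba) subrr.
Qed.

Lemma slack_skew_delta p i : p \in free_pairs phi ->
  slack (skew_delta p) 0 (fun=> 0) i (phi i) = 0.
Proof. by move=> pf; rewrite /slack skew_delta_phi // !subr0 addr0. Qed.

Lemma reduced_skew_delta p i j : p \in free_pairs phi ->
  red i j (skew_delta p) = - skew_delta p i j.
Proof.
move=> pf; rewrite /red (reducedE phir (fun i => slack_skew_delta i pf)) /slack.
ring.
Qed.

(** The remaining slacks are [lam] on the diagonal, 0 on edges and [2 lam] on reversed edges. *)
Lemma reduced_ge0_cases A : skew_symmetric R n A -> 0 <= lam A ->
  (forall i j, (i, j) \in free_pairs phi -> 0 <= red i j A) ->
  forall i j, 0 <= red i j A.
Proof.
move=> sA l0 f0 i j; case: (pair_cases phi i j) => [<-|<-|<-|/f0//].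
- by rewrite /red reduced_diag.
- by rewrite /red reduced_phi.
have := reduced_skew phi r j (phi j) sA.
by rewrite reduced_phi // -/(red _ _ _) -/(lam A); lra.
Qed.

Lemma reduced_gt0_cases A : skew_symmetric R n A -> 0 < lam A ->
  (forall i j, (i, j) \in free_pairs phi -> 0 < red i j A) ->
  forall i j, phi i != j -> 0 < red i j A.
Proof.
move=> sA l0 f0 i j; case: (pair_cases phi i j) => [<-|<-|<-|/f0//].
- by rewrite /red reduced_diag.
- by rewrite eqxx.
have := reduced_skew phi r j (phi j) sA.
by rewrite reduced_phi // -/(red _ _ _) -/(lam A); lra.
Qed.

Section Isomorphism.
Variables (m N : nat) (v : 'I_m -> 'I_n) (e : 'I_N -> 'I_n * 'I_n).
Hypothesis v_inj : injective v.
Hypothesis vP : forall i, i \in [set~ r]%SET <-> exists k, v k = i.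
Hypothesis e_inj : injective e.
Hypothesis eP : forall p, p \in upper_free_pairs phi <-> exists k, e k = p.

(** Recentring moves the slack interval from [[0, 2 lam]] to [[- lam, lam]], the standard interval
    scaled by [lam]. *)
Definition cube_coord (k : 'I_N) A : R := lam A - red (e k).1 (e k).2 A.

Definition kite_coords A : ('rV[R]_m * (R^o * 'rV[R]_N))%type :=
  (\row_k pot (v k) A, (lam A, \row_k cube_coord k A)).

Lemma kite_coords_linear : linear kite_coords.
Proof.
move=> a A B; rewrite /kite_coords; congr (_, (_, _)).
- by apply/rowP => k; rewrite !mxE /pot linearP.
- exact: linearP.
- apply/rowP => k; rewrite !mxE /cube_coord /lam /red !linearP /=.
  by rewrite /GRing.scale /=; ring.
Qed.

HB.instance Definition _ := GRing.isLinear.Build R 'M[R]_n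
  ('rV[R]_m * (R^o * 'rV[R]_N))%type *:%R kite_coords kite_coords_linear.

Let e_free k : ((e k).1, (e k).2) \in free_pairs phi.
Proof.
have /eP : exists k', e k' = e k by exists k.
by rewrite inE -surjective_pairing => /andP[].
Qed.

Lemma kite_coords_inj A B : skew_symmetric R n A -> skew_symmetric R n B ->
  kite_coords A = kite_coords B -> A = B.
Proof.
move=> sA sB [/rowP Ev El /rowP Ee].
have Epot i : pot i A = pot i B.
  have [->|ir] := eqVneq i r; first by rewrite /pot !potential_root.
  have /vP[k <-] : i \in [set~ r]%SET by rewrite !inE.
  by have := Ev k; rewrite !mxE.
have Eup i j : (i, j) \in upper_free_pairs phi -> red i j A = red i j B.
  case/eP=> k ek; have := Ee k.
  by rewrite !mxE /cube_coord ek El => /addrI/oppr_inj.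
have Ered i j : red i j A = red i j B.
  have sAij := reduced_skew phi r i j sA; have sBij := reduced_skew phi r i j sB.
  move: sAij sBij; rewrite -!/(red _ _ _) -!/(lam _) El.
  case: (pair_cases phi i j) => [<-|<-|<-|/upper_free_cases[/Eup//|/Eup->]].
  - by move=> _ _; rewrite /red !reduced_diag.
  - by move=> _ _; rewrite /red !reduced_phi.
  - by rewrite /red ![reduced phi r j (phi j) _]reduced_phi //; lra.
  - lra.
apply/matrixP => i j; have := Ered i j; rewrite /red /reduced /slack.
by rewrite -!/(pot _ _) -!/(lam _) El !Epot => /addrI/oppr_inj.
Qed.

(** The preimage is [y_i - y_j + g_ij], with [y] extending [x] by 0 at [r] and [g] equal to [t] on
    edges and to [u] on the upper free pairs; the pair [(t, y)] has zero slack along [phi]. *)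
Lemma kite_coords_surj (x : 'rV[R]_m) (t : R) (u : 'rV[R]_N) :
  exists2 A, skew_symmetric R n A & kite_coords A = (x, (t, u)).
Proof.
pose y i := \sum_k x 0 k * (v k == i)%:R.
pose g := t *: kite_center phi + \sum_k u 0 k *: skew_delta (e k).
pose A := \matrix_(i, j) (y i - y j + g i j).
have gE i j : g i j =
    t * kite_center phi i j + \sum_k u 0 k * skew_delta (e k) i j.
  by rewrite mxE [in LHS]mxE summxE; under eq_bigr do rewrite mxE.
have sg i j : g i j + g j i = 0.
  rewrite !gE addrACA -mulrDr kite_center_skew mulr0 add0r -big_split big1 //.
  by move=> k _ /=; rewrite -mulrDr skew_delta_skew mulr0.
have gphi i : g i (phi i) = t.
  rewrite gE big1 => [|k _]; first by rewrite mxE eqxx (negPf (phi2 i)) /=; ring.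
  by rewrite skew_delta_phi ?mulr0 // [e k]surjective_pairing.
have s0 i : slack A t y i (phi i) = 0 by rewrite /slack mxE gphi; ring.
have yv k : y (v k) = x 0 k.
  rewrite /y (bigD1 k) //= eqxx big1 ?addr0 ?mulr1 // => k' k'k.
  by rewrite (inj_eq v_inj) (negPf k'k) mulr0.
have yr : y r = 0.
  rewrite /y big1 // => k _; have /vP : exists k', v k' = v k by exists k.
  by rewrite !inE => /negPf ->; rewrite mulr0.
exists A; first by move=> i j; rewrite ![A _ _]mxE; have := sg i j; lra.
rewrite /kite_coords /lam (eigvalE phir s0); congr (_, (_, _)).
  by apply/rowP => k; rewrite mxE /pot (potentialE phir s0) yv yr subr0.
apply/rowP => k; rewrite mxE /cube_coord /red /lam (reducedE phir s0).
rewrite (eigvalE phir s0) /slack mxE gE.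
have -> : kite_center phi (e k).1 (e k).2 = 0 :> R.
  have := e_free k; rewrite mxE inE /= => /and3P[_ /negPf -> /negPf ->].
  exact: subrr.
rewrite (bigD1 k) //= big1 => [|k' k'k]; rewrite !mxE -surjective_pairing.
  rewrite eqxx (_ : (_ == e k) = false) /=; first ring.
  apply/negP => /eqP/(congr1 fst)/= E; have := e_free k.
  by rewrite inE /= E eqxx.
rewrite (inj_eq e_inj) eq_sym (negPf k'k) (_ : (_ == e k') = false).
  by rewrite subrr mulr0.
have up l : ((e l).1 < (e l).2)%N.
  by have /eP : exists l', e l' = e l by [exists l]; rewrite inE => /andP[].
apply/negP => /eqP E; have := up k'; have := up k; rewrite -E /=; lia.
Qed.

Lemma kite_coords_bij : set_bij (skew_symmetric R n) setT kite_coords.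
Proof.
split=> // [A B sA sB|[x [t u]] _].
  by apply: kite_coords_inj; [apply: set_mem sA|apply: set_mem sB].
by have [A sA <-] := kite_coords_surj x t u; exists A.
Qed.

Lemma kite_coords_image :
  kite_coords @` skew_cone R phi = setT `*` cone_over (standard_cube R N).
Proof.
apply/seteqP; split=> [_ [A /(skew_coneE phir phi2)[sA A0] <-]|[x q]].
  split=> //=; have l0 : 0 <= lam A by rewrite /lam -(reduced_diag _ _ r sA).
  exists (lam A), (\row_k (cube_coord k A / lam A)); split=> //.
    (* For eigenvalue 0 the quotient defaults to 0, which is in the cube; the coordinates are then 0
       as well, since opposite slacks are nonnegative with sum 0. *)
    move=> k; rewrite mxE; have [z|l_neq0] := eqVneq (lam A) 0.
      by rewrite z invr0 mulr0; lra.
    have l_gt0 : 0 < lam A by rewrite lt0r l_neq0.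
    rewrite ler_pdivrMr // ler_pdivlMr // /cube_coord.
    have := reduced_skew phi r (e k).1 (e k).2 sA.
    have := A0 (e k).1 (e k).2; have := A0 (e k).2 (e k).1.
    by rewrite -!/(red _ _ _) -!/(lam _); lra.
  congr (_, _); apply/rowP => k; rewrite !mxE.
  have [z|l_neq0] := eqVneq (lam A) 0; last by rewrite mulrC divfK.
  rewrite z mul0r /cube_coord z.
  have := reduced_skew phi r (e k).1 (e k).2 sA.
  have := A0 (e k).1 (e k).2; have := A0 (e k).2 (e k).1.
  by rewrite -!/(red _ _ _) -!/(lam _) z; lra.
case=> _ /= [t [p [t0 cube ->]]].
have [A sA EA] := kite_coords_surj x t (t *: p); exists A => //.
case: EA => _ El /rowP Ee.
apply/(skew_coneE phir phi2); split=> //; apply: reduced_ge0_cases => //.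
  by rewrite El.
have bnd i j : (i, j) \in upper_free_pairs phi ->
    0 <= red i j A /\ 0 <= red j i A.
  move=> /eP[k ek]; have := Ee k; rewrite !mxE /cube_coord ek El /=.
  have := reduced_skew phi r i j sA; rewrite -!/(red _ _ _) -!/(lam _) El.
  by have /andP[] := cube k; nra.
by move=> i j /upper_free_cases[/bnd[]|/bnd[]].
Qed.

End Isomorphism.
End Coordinates.

Lemma half_free_pairs n : (3 <= n)%N -> (n * (n - 3) %/ 2 = 'C(n, 2) - n)%N.
Proof.
move=> n3; rewrite bin2 -divn2; have -> : (n * n.-1 = n * (n - 3) + n * 2)%N.
  by rewrite -mulnDr; congr (_ * _)%N; lia.
by rewrite addnC divnMDl // addKn.
Qed.

Lemma kite_cone_isomorphism (R : realType) (n : nat)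
    (phi : {ffun 'I_n -> 'I_n}) : kite phi ->
  exists f : {linear 'M[R]_n ->
               ('rV[R]_(n - 1) * (R^o * 'rV[R]_((n * (n - 3)) %/ 2)))%type},
    set_bij (skew_symmetric R n) setT f /\
    f @` skew_cone R phi =
      setT `*` cone_over (standard_cube R ((n * (n - 3)) %/ 2)).
Proof.
case/kiteP=> r [phir phi2].
have cv : #|[set~ r]%SET| = (n - 1)%N by rewrite cardsC1 card_ord subn1.
have [v [v_inj vP]] := set_enumeration cv.
have [e [e_inj eP]] := set_enumeration (card_upper_free_pairs phi2).
exists (kite_coords phi r v e); split; first exact: kite_coords_bij.
exact: kite_coords_image.
Qed.

(** * Spans and dimensions *)

Section Spans.
Context {R : realType} {V : vectType R}.
Implicit Types (S : set V) (W : {vspace V}).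

Lemma linear_span_uniq S W W' : linear_span S W -> linear_span S W' -> W = W'.
Proof.
move=> [SW Wmin] [SW' W'min]; apply/eqP.
by rewrite eqEsubv Wmin // W'min.
Qed.

(** A direction [v] is a multiple of the difference of the points [p + e v] and [p] of [S]. *)
Lemma linear_span_perturb S W p : (forall v, S v -> v \in W) -> S p ->
  (forall v, v \in W -> exists2 e : R, e != 0 & S (p + e *: v)) ->
  linear_span S W.
Proof.
move=> SW Sp pert; split=> // W' SW'; apply/subvP => v /pert[e e0 /SW' pv].
have -> : v = e^-1 *: (p + e *: v - p).
  by rewrite addrAC subrr add0r scalerA mulVf // scale1r.
by rewrite memvZ // memvB // SW'.
Qed.

Lemma dim_hyperplane W (l : {linear V -> R^o}) v : v \in W -> l v != 0 ->
  \dim W = (\dim (W :&: lker (linfun l))).+1.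
Proof.
move=> vW lv; rewrite -(limg_ker_dim (linfun l) W).
have -> : (linfun l @: W)%VS = <[(linfun l v : R^o)]>%VS.
  apply/eqP; rewrite eqEsubv -memvE memv_img // andbT; apply/subvP => w _.
  by apply/vlineP; exists (w / l v); rewrite lfunE /= -[_ *: _]/(_ * _) divfK.
by rewrite dim_vline lfunE /= lv addn1.
Qed.

End Spans.

(** * Facets of a kite cone, and failure of simpliciality *)

Section Facets.
Context {R : realType} {n : nat}.
Variables (phi : {ffun 'I_n -> 'I_n}) (r : 'I_n).
Hypothesis phir : forall i, fconnect phi i r.
Hypothesis phi2 : forall i, phi (phi i) != i.
Implicit Types (A B : 'M[R]_n) (i j : 'I_n) (p q : 'I_n * 'I_n).
Let red := @reduced R n phi r.
Let lam := @eigval R n phi r.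
Let C := skew_cone R phi.
Let CE A : C A <-> skew_symmetric R n A /\ forall i j, 0 <= red i j A.
Proof. exact: skew_coneE. Qed.

Definition skew_space : {vspace 'M[R]_n} := lker (linfun (idfun \+ @trmx R n n)).

Lemma skew_spaceP A : A \in skew_space <-> skew_symmetric R n A.
Proof.
rewrite memv_ker lfunE /=; split=> [/eqP/matrixP sA i j|sA].
  by have := sA i j; rewrite !mxE.
by apply/eqP/matrixP => i j; rewrite !mxE.
Qed.

Definition reduced_hyperplane p : {vspace 'M[R]_n} :=
  (skew_space :&: lker (linfun (reduced phi r p.1 p.2)))%VS.

Lemma reduced_hyperplaneP p A : A \in reduced_hyperplane p <->
  skew_symmetric R n A /\ red p.1 p.2 A = 0.
Proof.
rewrite memv_cap memv_ker lfunE /=.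
by split=> [/andP[/skew_spaceP sA /eqP //]|[/skew_spaceP -> /eqP]].
Qed.

Lemma span_skew_cone : linear_span C skew_space.
Proof.
have [sc strict] : skew_symmetric R n (kite_center phi) /\
    forall i j, phi i != j -> 0 < red i j (kite_center phi).
  by split; [apply: kite_center_skew|apply: reduced_center_gt0].
apply: (@linear_span_perturb _ _ _ _ (kite_center phi)).
- by move=> A /CE[sA _]; apply/skew_spaceP.
- exact: (strict_skew_cone phir phi2 sc strict).
move=> B /skew_spaceP sB.
have [e e0 eC] := reduced_gt0_line (Q := fun i j => phi i != j) B strict.
exists e; first exact: lt0r_neq0.
apply: (strict_skew_cone phir phi2); first exact: skew_symmetricP.
by apply: eC; rewrite gtr0_norm.
Qed.

Definition kite_facet p : set 'M[R]_n := [set A | C A /\ red p.1 p.2 A = 0].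

(** The centre of a cube facet: for a free pair [p] the slack of [p] drops to 0, and every other
    slack off the edges of [phi] stays positive. *)
Definition facet_center p : 'M[R]_n := kite_center phi + skew_delta p.

Lemma facet_center_skew p : skew_symmetric R n (facet_center p).
Proof.
rewrite /facet_center -[skew_delta p]scale1r.
by apply: skew_symmetricP; [apply: kite_center_skew|apply: skew_delta_skew].
Qed.

Lemma reduced_facet_center p i j : p \in free_pairs phi ->
  red i j (facet_center p) =
  1 - (phi i == j)%:R + (phi j == i)%:R - ((i, j) == p)%:R + ((j, i) == p)%:R.
Proof.
move=> pf; rewrite /red linearD /= reduced_center // reduced_skew_delta // mxE.
ring.
Qed.

Lemma facet_center_eq0 p : p \in free_pairs phi ->
  red p.1 p.2 (facet_center p) = 0.
Proof.
move=> pf; rewrite reduced_facet_center // -surjective_pairing eqxx.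
have := pf; case: p pf => a b _; rewrite inE xpair_eqE /=.
by move=> /and3P[/negPf ab /negPf -> /negPf ->]; rewrite ab andbF /=; ring.
Qed.

Lemma facet_center_gt0 p i j : p \in free_pairs phi ->
  (phi i != j) && ((i, j) != p) -> 0 < red i j (facet_center p).
Proof.
move=> pf /andP[/negPf ij /negPf ijp]; rewrite reduced_facet_center // ij ijp.
by do 2!case: eqP => _ /=; lra.
Qed.

Lemma kite_facet_center p : p \in free_pairs phi ->
  kite_facet p (facet_center p).
Proof.
move=> pf; split; last exact: facet_center_eq0.
apply/CE; split=> [|i j]; first exact: facet_center_skew.
have [<-|ij] := eqVneq (phi i) j; first by rewrite /red reduced_phi.
have [ijp|ijp] := eqVneq (i, j) p.
  by have := facet_center_eq0 pf; rewrite -ijp => ->.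
by apply/ltW/facet_center_gt0 => //; rewrite ij.
Qed.

Lemma span_kite_facet p : p \in free_pairs phi ->
  linear_span (kite_facet p) (reduced_hyperplane p).
Proof.
move=> pf; apply: (@linear_span_perturb _ _ _ _ (facet_center p)).
- by move=> A [/CE[sA _] pA]; apply/reduced_hyperplaneP.
- exact: kite_facet_center.
move=> B /reduced_hyperplaneP[sB pB].
have [e e0 eC] := reduced_gt0_line
  (Q := fun i j => (phi i != j) && ((i, j) != p)) B
  (fun i j => @facet_center_gt0 p i j pf).
exists e; first exact: lt0r_neq0.
have p0 : red p.1 p.2 (facet_center p + e *: B) = 0.
  rewrite /red linearD linearZ /= -!/(red _ _ _) pB scaler0 addr0.
  exact: facet_center_eq0.
split=> //; apply/CE; split=> [|i j].
  by apply: skew_symmetricP => //; apply: facet_center_skew.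
have [<-|ij] := eqVneq (phi i) j; first by rewrite /red reduced_phi.
have [ijp|ijp] := eqVneq (i, j) p; first by move: p0; rewrite -ijp => ->.
by apply/ltW/eC; rewrite ?gtr0_norm // ij.
Qed.

Lemma kite_facet_facet p : p \in free_pairs phi -> facet C (kite_facet p).
Proof.
move=> pf; split.
  by exists (reduced phi r p.1 p.2); split=> // A /CE[_ A0]; apply: A0.
exists skew_space, (reduced_hyperplane p); split.
- exact: span_skew_cone.
- exact: span_kite_facet.
apply: (@dim_hyperplane _ _ _ _ (kite_center phi)).
  by apply/skew_spaceP; apply: kite_center_skew.
rewrite gt_eqF // reduced_center_gt0 //.
by move: pf; rewrite inE => /and3P[].
Qed.

Lemma kite_facet_inj : {in free_pairs phi &, injective kite_facet}.
Proof.
move=> p q pf qf E; have := kite_facet_center qf; rewrite -E => -[_ p0].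
have [//|pq] := eqVneq p q; suff : 0 < red p.1 p.2 (facet_center q).
  by rewrite p0 ltxx.
apply: facet_center_gt0 => //; rewrite -surjective_pairing pq andbT.
by move: pf; rewrite inE => /and3P[].
Qed.

(* If F lies in no kite_facet, summing witnesses gives a point of F interior to
   the cone, on which no functional nonnegative on the cone can vanish. *)
Lemma facet_kite_facet F p0 : p0 \in free_pairs phi -> facet C F ->
  exists2 p, p \in free_pairs phi & F = kite_facet p.
Proof.
move=> p0f [[l [lC FE]] [WC [WF [sWC sWF dimE]]]].
have {}WCE := linear_span_uniq sWC span_skew_cone; subst WC.
have [[p pf Fp]|noP] := pselect (exists2 p, p \in free_pairs phi &
    forall A, F A -> red p.1 p.2 A = 0).
  exists p => //; have FWp A : F A -> A \in reduced_hyperplane p.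
    move=> FA; apply/reduced_hyperplaneP; split; last exact: Fp.
    by move: FA; rewrite FE => -[/CE[]].
  (* One span contains the other and both have codimension one in [skew_space]. *)
  have WFp : WF = reduced_hyperplane p.
    have [_ /(_ _ FWp) sub] := sWF; apply/eqP; rewrite eqEdim sub /=.
    have [_ [W1 [W2 [s1 s2 d12]]]] := kite_facet_facet pf.
    move: d12; rewrite (linear_span_uniq s1 span_skew_cone).
    by rewrite (linear_span_uniq s2 (span_kite_facet pf)) dimE => -[->].
  apply/seteqP; split=> A FA.
    by split; [move: FA; rewrite FE => -[]|apply: Fp].
  have : A \in WF.
    rewrite WFp; have [sub _] := span_kite_facet pf; exact: sub.
  have lWF : (WF <= lker (linfun l))%VS.
    have [_ ] := sWF; apply=> B; rewrite FE => -[_ lB].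
    by rewrite memv_ker lfunE /= lB.
  move=> /(subvP lWF); rewrite memv_ker lfunE /= => /eqP lA.
  by rewrite FE; case: FA.
have wit p : exists A, p \in free_pairs phi -> F A /\ 0 < red p.1 p.2 A.
  have [pf|] := boolP (p \in free_pairs phi); last by exists 0.
  have [Fp|/existsNP[A /not_implyP[FA pA]]] :=
    pselect (forall A, F A -> red p.1 p.2 A = 0); first by case: noP; exists p.
  exists A => _; split=> //; rewrite lt0r; apply/andP; split; first exact/eqP.
  by move: FA; rewrite FE => -[/CE[_ A0] _]; apply: A0.
have [a aP] := choice wit; pose A := \sum_(p in free_pairs phi) a p.
have aC p : p \in free_pairs phi -> C (a p).
  by case/aP; rewrite FE => -[].
have sA : skew_symmetric R n A.
  apply/skew_spaceP; apply: memv_suml => p /aC/CE[sa _]; exact/skew_spaceP.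
have pA i j : (i, j) \in free_pairs phi -> 0 < red i j A.
  move=> ij; rewrite /red /A linear_sum (bigD1 (i, j)) //=.
  rewrite ltr_pwDl //; first by case: (aP _ ij).
  by apply: sumr_ge0 => p /andP[/aC/CE[_ ->]].
have l0A : 0 < lam A.
  have := reduced_skew phi r p0.1 p0.2 sA; rewrite -/(lam A) -!/(red _ _ _).
  have := pA p0.1 p0.2; have := pA p0.2 p0.1.
  rewrite -free_pairs_swap -surjective_pairing => /(_ p0f) + /(_ p0f); lra.
have strict := reduced_gt0_cases phir sA l0A pA.
have lA : l A = 0.
  by rewrite linear_sum big1 // => p /aP[]; rewrite FE => -[].
(* From the interior point [A] one may step along both [B] and [- B] inside the cone, where [l] is
   nonnegative. So [F] is the whole cone, against the drop in dimension. *)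
have l0 B : skew_symmetric R n B -> l B = 0.
  move=> sB.
  have [e e0 eC] := reduced_gt0_line (Q := fun i j => phi i != j) B strict.
  have lt t : `|t| <= e -> 0 <= t * l B.
    move=> te; have := lC (A + t *: B); rewrite linearD lA linearZ add0r; apply.
    by apply: (strict_skew_cone phir phi2); [apply: skew_symmetricP|apply: eC].
  have := lt e; have := lt (- e); rewrite normrN gtr0_norm // lexx.
  by rewrite mulNr oppr_ge0 pmulr_rle0 // pmulr_rge0 // => /(_ isT) + /(_ isT); lra.
have FC : F = C.
  rewrite FE; apply/seteqP; split=> [B []//|B CB].
  by split=> //; case/CE: CB => /l0.
move: sWF dimE; rewrite FC => /linear_span_uniq/(_ span_skew_cone) <-.
by move=> /eqP; rewrite -[X in X == _]addn0 -addn1 eqn_add2l.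
Qed.

Lemma card_facets p0 : p0 \in free_pairs phi ->
  ([set F | facet C F] #= `I_(n * (n - 3)))%card.
Proof.
move=> p0f; rewrite card_eq_sym; apply/card_set_bijP.
have sz : size (enum (free_pairs phi)) = (n * (n - 3))%N.
  by rewrite -cardE card_free_pairs.
have nthf k : (k < n * (n - 3))%N ->
    nth p0 (enum (free_pairs phi)) k \in free_pairs phi.
  by move=> kn; rewrite -mem_enum mem_nth ?sz.
exists (fun k => kite_facet (nth p0 (enum (free_pairs phi)) k)); split.
- by move=> k /= kn; apply/kite_facet_facet/nthf.
- move=> k m; rewrite !inE /= => kn mn /kite_facet_inj.
  move=> /(_ (nthf _ kn) (nthf _ mn))/eqP.
  by rewrite nth_uniq ?sz ?enum_uniq // => /eqP.
- move=> F /(facet_kite_facet p0f)[p pf ->].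
  exists (index p (enum (free_pairs phi))) => /=; last first.
    by rewrite nth_index // mem_enum.
  by rewrite -sz index_mem mem_enum.
Qed.

(* The two diagonals of a square face of the cube have the same midpoint;
   in a simplicial cone this would force that midpoint into the lineality space. *)
Lemma skew_cone_not_simplicial p q :
  p \in free_pairs phi -> q \in free_pairs phi -> q != p -> q != (p.2, p.1) ->
  ~ simplicial_cone C.
Proof.
move=> pf qf qp qp' [L [k [s [s_free Ls CS]]]].
have ne i j : (i, j) \in free_pairs phi -> (i == j) = false.
  by rewrite inE => /and3P[/negPf].
have dd i j : (i, j) \in free_pairs phi -> skew_delta (i, j) i j = 1 :> R.
  by move=> /ne ij; rewrite mxE eqxx xpair_eqE [j == i]eq_sym ij /= subr0.
have d0 i j t : (i, j) != t -> (j, i) != t -> skew_delta t i j = 0 :> R.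
  by rewrite mxE => /negPf -> /negPf ->; rewrite subrr.
case: p q pf qf qp qp' => p1 p2 [q1 q2] pf qf qp /= qp'.
have qp'' : (q2, q1) != (p1, p2).
  by apply: contraNneq qp' => -[-> ->].
have qp3 : (q2, q1) != (p2, p1) by apply: contraNneq qp => -[-> ->].
have dpq : skew_delta (p1, p2) q1 q2 = 0 :> R by apply: d0.
have dqp : skew_delta (q1, q2) p1 p2 = 0 :> R by apply: d0; rewrite eq_sym.
(* A square slice of the cone through its centre, with [a] and [b] the cube coordinates of the two
   pairs. *)
pose E (a b : R) : 'M[R]_n := kite_center phi + a *: skew_delta (p1, p2)
  + b *: skew_delta (q1, q2).
have EE a b i j : E a b i j = kite_center phi i j + a * skew_delta (p1, p2) i j
    + b * skew_delta (q1, q2) i j by rewrite /E !mxE.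
have sE a b : skew_symmetric R n (E a b).
  apply: skew_symmetricP (skew_delta_skew _).
  by apply: skew_symmetricP (skew_delta_skew _); apply: kite_center_skew.
have slackE a b i : slack (E a b) 1 (fun=> 0) i (phi i) = 0.
  rewrite /slack EE !skew_delta_phi // mxE eqxx (negPf (phi2 i)) /=; ring.
have lamE a b : lam (E a b) = 1 by apply: eigvalE phir _ _ _ (slackE a b).
have redE a b i j : (i, j) \in free_pairs phi -> red i j (E a b) =
    1 - a * skew_delta (p1, p2) i j - b * skew_delta (q1, q2) i j.
  rewrite /red (reducedE phir (slackE a b)) /slack EE [kite_center _ _ _]mxE inE.
  by move=> /and3P[_ /= /negPf -> /negPf ->] /=; ring.
have redp a b : red p1 p2 (E a b) = 1 - a by rewrite redE // dd // dqp; ring.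
have redq a b : red q1 q2 (E a b) = 1 - b by rewrite redE // dd // dpq; ring.
have redp' a b : red p2 p1 (E a b) = 1 + a.
  have := reduced_skew phi r p1 p2 (sE a b).
  by rewrite -!/(red _ _ _) -/(lam _) redp lamE; lra.
have redq' a b : red q2 q1 (E a b) = 1 + b.
  have := reduced_skew phi r q1 q2 (sE a b).
  by rewrite -!/(red _ _ _) -/(lam _) redq lamE; lra.
have CEab a b : -1 <= a <= 1 -> -1 <= b <= 1 -> C (E a b).
  move=> a1 b1; apply/CE; split=> //.
  apply: reduced_ge0_cases => //; first by rewrite -/(lam _) lamE.
  move=> i j ij; rewrite -/(red _ _ _).
  have [[-> ->]|ijp] := eqVneq (i, j) (p1, p2); first by rewrite redp; lra.
  have [[-> ->]|jip] := eqVneq (j, i) (p1, p2); first by rewrite redp'; lra.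
  have [[-> ->]|ijq] := eqVneq (i, j) (q1, q2); first by rewrite redq; lra.
  have [[-> ->]|jiq] := eqVneq (j, i) (q1, q2); first by rewrite redq'; lra.
  by rewrite redE // !d0 // !mulr0; lra.
have s_tnth (t : 'I_k) : tnth s t = s`_t by apply: tnth_nth.
have Cs (t : 'I_k) : C (tnth s t).
  rewrite CS; exists 0; rewrite ?mem0v //; exists (fun m => (m == t)%:R) => //.
  by rewrite (bigD1 t) //= eqxx scale1r big1 ?addr0 ?add0r // => m /negPf ->;
    rewrite scale0r.
have CL u : u \in L -> C u.
  move=> uL; rewrite CS; exists u => //; exists (fun=> 0) => //.
  by rewrite big1 ?addr0 // => t _; rewrite scale0r.
have redL i j u : u \in L -> red i j u = 0.
  move=> uL; have [_ /(_ i j)] := (CE _).1 (CL _ uL).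
  have [_ /(_ i j)] := (CE _).1 (CL (- u) ltac:(by rewrite memvN)).
  by rewrite {1}/red linearN /= -/(red _ _ _); lra.
have dec a b : -1 <= a <= 1 -> -1 <= b <= 1 -> exists c : 'I_k -> R,
    (forall t, 0 <= c t) /\ E a b - \sum_(i < k) c i *: tnth s i \in L.
  move=> a1 b1; have := CEab a b a1 b1; rewrite CS => -[u uL [c c0 Euc]].
  by exists c; split=> //; rewrite Euc addrK.
have red_dec i j A (c : 'I_k -> R) : A - \sum_(i < k) c i *: tnth s i \in L ->
    red i j A = \sum_(t < k) c t * red i j (tnth s t).
  move=> /(redL i j); rewrite /red linearB linear_sum /= => /subr0_eq ->.
  by apply: eq_bigr => t _; rewrite linearZ.
(* A generator occurring with positive coefficient in a point of zero slack has that slack zero. *)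
have zero i j A (c : 'I_k -> R) t : (forall t, 0 <= c t) ->
    A - \sum_(i < k) c i *: tnth s i \in L -> red i j A = 0 -> 0 < c t ->
    red i j (tnth s t) = 0.
  move=> c0 cL; rewrite (red_dec i j A c cL) => /eqP.
  rewrite psumr_eq0 => [|m _]; last first.
    by apply: mulr_ge0 => //; have [_ ->] := (CE _).1 (Cs m).
  move=> /allP/(_ t (mem_index_enum _)) /= + ct.
  by rewrite mulf_eq0 gt_eqF //= => /eqP.
have u1 : -1 <= (1 : R) <= 1 by lra.
have u2 : -1 <= (- 1 : R) <= 1 by lra.
have [c11 [c11_0 L11]] := dec 1 1 u1 u1.
have [c12 [c12_0 L12]] := dec 1 (- 1) u1 u2.
have [c21 [c21_0 L21]] := dec (- 1) 1 u2 u1.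
have [c22 [c22_0 L22]] := dec (- 1) (- 1) u2 u2.
(* Opposite corners of the square have equal sums, and the generators are independent modulo [L]. *)
have diag (t : 'I_k) : c11 t + c22 t = c12 t + c21 t.
  suff /(_ t) : forall t, c11 t + c22 t - c12 t - c21 t = 0 by lra.
  move/freeP: s_free; apply.
  apply/eqP; rewrite -memv0 -Ls memv_cap; apply/andP; split; last first.
    by apply: memv_suml => m _; apply/memvZ/memv_span; rewrite -s_tnth mem_tnth.
  have := memvB (memvD L12 L21) (memvD L11 L22); congr (_ \in L).
  have -> : \sum_(m < k) (c11 m + c22 m - c12 m - c21 m) *: s`_m =
      \sum_(m < k) c11 m *: tnth s m + \sum_(m < k) c22 m *: tnth s m -
      \sum_(m < k) c12 m *: tnth s m - \sum_(m < k) c21 m *: tnth s m.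
    rewrite -big_split -!sumrB; apply: eq_bigr => m _ /=.
    by rewrite s_tnth !scalerBl scalerDl.
  have -> : E 1 (-1) = E 1 1 + E (-1) (-1) - E (-1) 1.
    by apply/matrixP => i' j'; rewrite /E !mxE; ring.
  set a11 := \sum_(m < k) c11 m *: _; set a22 := \sum_(m < k) c22 m *: _.
  set a12 := \sum_(m < k) c12 m *: _; set a21 := \sum_(m < k) c21 m *: _.
  apply/matrixP => i' j'; rewrite !mxE; ring.
(* By [diag] a generator used at the corner [(1, 1)] is used at an adjacent corner. There the slack
   of a reversed pair vanishes too, so two opposite slacks are 0 and the eigenvalue, the diagonal
   slack, is 0. *)
have lam0 (t : 'I_k) : 0 < c11 t -> red r r (tnth s t) = 0.
  move=> ct; have [ss _] := (CE _).1 (Cs t).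
  have zp := zero p1 p2 _ c11 t c11_0 L11; rewrite redp subrr in zp.
  have zq := zero q1 q2 _ c11 t c11_0 L11; rewrite redq subrr in zq.
  have lam2 a b : red a b (tnth s t) = 0 -> red b a (tnth s t) = 0 ->
      red r r (tnth s t) = 0.
    move=> ab ba; have := reduced_skew phi r a b ss.
    by rewrite -!/(red _ _ _) ab ba /red reduced_diag // -/(lam _); lra.
  have [c12i|c12i] := ltP 0 (c12 t).
    have zq' := zero q2 q1 _ c12 t c12_0 L12; rewrite redq' subrr in zq'.
    exact: lam2 (zq erefl ct) (zq' erefl c12i).
  have c21i : 0 < c21 t by have := diag t; have := c22_0 t; lra.
  have zp' := zero p2 p1 _ c21 t c21_0 L21; rewrite redp' subrr in zp'.
  exact: lam2 (zp erefl ct) (zp' erefl c21i).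
have := red_dec r r _ _ L11; rewrite big1 => [|t _]; last first.
  have := c11_0 t; rewrite le_eqVlt => /predU1P[<-|/lam0 ->].
    by rewrite mul0r.
  by rewrite mulr0.
by rewrite /red reduced_diag // -/(lam _) lamE => /eqP; rewrite oner_eq0.
Qed.

End Facets.

Lemma kite_facets (R : realType) (n : nat) (phi : {ffun 'I_n -> 'I_n}) :
  kite phi -> (4 <= n)%N ->
  ([set F | facet (skew_cone R phi) F] #= `I_(n * (n - 3)))%card /\
  ~ simplicial_cone (skew_cone R phi).
Proof.
case/kiteP=> r [phir phi2] n4; have cf := card_free_pairs phi2.
have /card_gt0P[p pf] : (0 < #|free_pairs phi|)%N by rewrite cf; nia.
split; first exact: (card_facets phir phi2 pf).
(* For [n] at least 4 there are at least four free pairs, more than [p] and its reverse. *)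
have : (0 < #|free_pairs phi :\: [set p; (p.2, p.1)]%SET|)%N.
  rewrite cardsD subn_gt0 (leq_ltn_trans (subset_leq_card (subsetIr _ _))) //.
  by rewrite cards2 cf; case: (_ != _); nia.
case/card_gt0P=> q; rewrite !finset.inE negb_or => /andP[/andP[qp qp'] qf].
by apply: (skew_cone_not_simplicial phir phi2 pf _ qp qp'); rewrite inE.
Qed.

(** * Two kite cones that do not meet in a common face *)

Section NotFan.
Context {R : realType} {n : nat}.
Hypothesis n6 : (6 <= n)%N.

(** Membership is tested on any explicit pair [(lam, x)], without computing the root or walk
    sums. *)
Lemma skew_coneP (phi : {ffun 'I_n -> 'I_n}) (A : 'M[R]_n) : kite phi ->
  skew_cone R phi A <-> skew_symmetric R n A /\
    exists lam x, (forall i j, 0 <= slack A lam x i j) /\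
      forall i, slack A lam x i (phi i) = 0.
Proof.
case/kiteP=> r [phir phi2]; rewrite (skew_coneE phir phi2).
split=> -[sA]; last first.
  by case=> lam [x [A0 Aphi]]; split=> // i j; rewrite (reducedE phir Aphi).
move=> A0; split=> //; exists (eigval phi r A), (potential phi r ^~ A).
by split=> [//|i]; apply: reduced_phi.
Qed.

Definition small_ord k (k6 : (k < 6)%N) : 'I_n := Ordinal (leq_trans k6 n6).

Definition small_fun (f : nat -> nat) (f6 : forall k, (f k < 6)%N) :
  {ffun 'I_n -> 'I_n} := [ffun i => small_ord (f6 (val i))].

Lemma small_fun_iter f f6 k i :
  val (iter k (@small_fun f f6) i) = iter k f (val i).
Proof. by elim: k => //= k <-; rewrite ffunE. Qed.

Lemma kite_small_fun f f6 r (r6 : (r < 6)%N) :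
  (forall k, exists t, iter t f k = r) -> (forall k, f (f k) != k) ->
  kite (@small_fun f f6).
Proof.
move=> fr f2; apply/kiteP; exists (small_ord r6); split=> i.
  have [t tr] := fr (val i); have <- : iter t (small_fun f6) i = small_ord r6.
    by apply: val_inj; rewrite small_fun_iter.
  exact: fconnect_iter.
by rewrite -val_eqE !ffunE /=.
Qed.

(* Both functions run through the triangles 0,1,2 and 3,4,5; the first has the
   cycle 0,1,2 and the second the cycle 3,4,5. *)
Definition fst_cycle k :=
  match k with 0 => 1 | 1 => 2 | 2 => 0 | 3 => 4 | 4 => 5 | _ => 0 end%N.

Definition snd_cycle k :=
  match k with 0 => 1 | 1 => 2 | 2 => 3 | 3 => 4 | 4 => 5 | 5 => 3 | _ => 0 end%N.

Lemma fst_cycle6 k : (fst_cycle k < 6)%N.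
Proof. by case: k => [|[|[|[|[|[|k]]]]]]. Qed.

Lemma snd_cycle6 k : (snd_cycle k < 6)%N.
Proof. by case: k => [|[|[|[|[|[|k]]]]]]. Qed.

Let phi := small_fun fst_cycle6.
Let psi := small_fun snd_cycle6.

Lemma kite_fst_cycle : kite phi.
Proof.
apply: (@kite_small_fun _ _ 0 isT).
  case=> [|[|[|[|[|[|k]]]]]]; by [exists 0|exists 1|exists 2|exists 3].
by case=> [|[|[|[|[|[|k]]]]]].
Qed.

Lemma kite_snd_cycle : kite psi.
Proof.
apply: (@kite_small_fun _ _ 3 isT).
  by case=> [|[|[|[|[|[|k]]]]]]; [exists 3|exists 2|exists 1|exists 0|exists 2
    |exists 1|exists 4].
by case=> [|[|[|[|[|[|k]]]]]].
Qed.

(** The first kite together with the edge that closes the second triangle, so that both triangles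
    attain the maximal mean. *)
Definition tri_edge (i j : nat) := (fst_cycle i == j) || (i == 5) && (j == 3).

Definition tri_matrix (t : R) : 'M[R]_n := \matrix_(i, j)
  ((tri_edge i j)%:R - (tri_edge j i)%:R +
   t * (((i == 2 :> nat) && (j == 3 :> nat))%:R -
        ((j == 2 :> nat) && (i == 3 :> nat))%:R)).

Lemma tri_matrix_skew t : skew_symmetric R n (tri_matrix t).
Proof. by move=> i j; rewrite !mxE; ring. Qed.

Lemma tri_matrix_fst t : -1 <= t <= 1 -> skew_cone R phi (tri_matrix t).
Proof.
move=> t1; apply/(skew_coneP _ kite_fst_cycle); split.
  exact: tri_matrix_skew.
exists 1, (fun=> 0); split=> [i j|i]; rewrite /slack mxE.
  case: i j => [i ilt] [j jlt] /=; rewrite /tri_edge.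
  move: i j {ilt jlt}.
  by case=> [|[|[|[|[|[|i]]]]]]; case=> [|[|[|[|[|[|j]]]]]] /=; lra.
rewrite ffunE /=; case: i => [i ilt] /=; rewrite /tri_edge; move: i {ilt}.
by case=> [|[|[|[|[|[|i]]]]]] /=; lra.
Qed.

Lemma tri_matrix_snd : skew_cone R psi (tri_matrix 0).
Proof.
apply/(skew_coneP _ kite_snd_cycle); split; first exact: tri_matrix_skew.
(* The edge from 2 to 3 has weight 0, so raising the potential by 1 on the second triangle makes it
   tight. *)
exists 1, (fun i => (3 <= i <= 5)%N%:R); split=> [i j|i]; rewrite /slack mxE.
  case: i j => [i ilt] [j jlt] /=; rewrite /tri_edge.
  move: i j {ilt jlt}.
  by case=> [|[|[|[|[|[|i]]]]]]; case=> [|[|[|[|[|[|j]]]]]] /=; lra.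
rewrite ffunE /=; case: i => [i ilt] /=; rewrite /tri_edge; move: i {ilt}.
by case=> [|[|[|[|[|[|i]]]]]] /=; lra.
Qed.

Lemma tri_matrix_not_snd t : t < 0 -> ~ skew_cone R psi (tri_matrix t).
Proof.
move=> t0 /(skew_coneP _ kite_snd_cycle)[_ [lam [x [A0 Apsi]]]].
have Ao k (k6 : (k < 6)%N) := Apsi (small_ord k6).
have psio k (k6 : (k < 6)%N) : psi (small_ord k6) = small_ord (snd_cycle6 k).
  by rewrite ffunE.
have e0 := Ao 0 isT; have e1 := Ao 1 isT; have e2 := Ao 2 isT.
have e3 := Ao 3 isT; have e4 := Ao 4 isT; have e5 := Ao 5 isT.
have o k (k6 k6' : (k < 6)%N) : small_ord k6 = small_ord k6' by apply: val_inj.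
(* The second triangle forces [lam = 1], and the edges from 0 to 3 force [x_3 = x_0 + 1 - t]; so the
   slack of [(0, 3)] equals [t], which is negative. *)
have e6 := A0 (@small_ord 0 isT) (@small_ord 3 isT).
move: e0 e1 e2 e3 e4 e5 e6; rewrite !psio /slack !mxE /tri_edge /=.
rewrite !(o 1 (snd_cycle6 0) isT) !(o 2 (snd_cycle6 1) isT).
rewrite !(o 3 (snd_cycle6 2) isT) !(o 4 (snd_cycle6 3) isT).
rewrite !(o 5 (snd_cycle6 4) isT) !(o 3 (snd_cycle6 5) isT).
lra.
Qed.

(* tri_matrix 0 lies in both cones and is the midpoint of two points of the
   first cone, only one of which lies in the second cone. *)
Lemma kite_cones_not_fan : ~ fan (all_faces (kite_cones R n)).
Proof.
case=> _ _ _ inter.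
have mem f : kite f -> all_faces (kite_cones R n) (skew_cone R f).
  move=> kf; exists (skew_cone R f); first by exists f.
  exists (\0 : {linear 'M[R]_n -> R^o}); split=> //.
  by apply/seteqP; split=> [A|A []].
have [[l [lC E]] _] := inter _ _ (mem _ kite_fst_cycle) (mem _ kite_snd_cycle).
have C0 : skew_cone R phi (tri_matrix 0) by apply: tri_matrix_fst; lra.
have : [set v | skew_cone R phi v /\ l v = 0] (tri_matrix 0).
  by rewrite -E; split=> //; apply: tri_matrix_snd.
case=> _ l0; have Cp : skew_cone R phi (tri_matrix 1) by apply: tri_matrix_fst; lra.
have Cm : skew_cone R phi (tri_matrix (- 1)) by apply: tri_matrix_fst; lra.
have mid : tri_matrix 1 + tri_matrix (- 1) = 2 *: tri_matrix 0.
  by apply/matrixP => i j; rewrite !mxE; ring.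
have := congr1 l mid; rewrite linearD linearZ /= l0 scaler0 => lpm.
have lm : l (tri_matrix (- 1)) = 0.
  by have := lC _ Cp; have := lC _ Cm; move: lpm; lra.
have : (skew_cone R phi `&` skew_cone R psi) (tri_matrix (- 1)) by rewrite E.
by case=> _; apply: tri_matrix_not_snd; rewrite oppr_lt0.
Qed.

End NotFan.

Theorem theorem4p1 (R : realType) (n : nat) (n_ge3 : (3 <= n)%N) :
  [/\ (* the maximal open cones of linearity are those given by kites *)
      (forall U : set 'M[R]_n,
         maximal_linearity_cone U <->
         exists2 phi, kite phi & U = relint (skew_cone R phi)),
      (* the linear functions are unique and distinct *)
      (forall phi : {ffun 'I_n -> 'I_n}, kite phi ->
         exists2 f, linear_representation (relint (skew_cone R phi)) f &
           forall g, linear_representation (relint (skew_cone R phi)) g ->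
             skew_map_eq g f) /\
      (forall (phi psi : {ffun 'I_n -> 'I_n}) f g,
         kite phi -> kite psi ->
         linear_representation (relint (skew_cone R phi)) f ->
         linear_representation (relint (skew_cone R psi)) g ->
         skew_map_eq f g -> phi = psi),
      (* facets *)
      (forall phi : {ffun 'I_n -> 'I_n}, kite phi -> (4 <= n)%N ->
         ([set F | facet (skew_cone R phi) F] #= `I_(n * (n - 3)))%card /\
         ~ simplicial_cone (skew_cone R phi)),
      (* R^(n-1) times the cone over the cube of dimension n(n-3)/2 *)
      ((n * (n - 3)) %/ 2 = 'C(n, 2) - n)%N /\
      (forall phi : {ffun 'I_n -> 'I_n}, kite phi ->
         exists f : {linear 'M[R]_n ->
                      ('rV[R]_(n - 1) * (R^o * 'rV[R]_((n * (n - 3)) %/ 2)))%type},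
           set_bij (skew_symmetric R n) setT f /\
           f @` skew_cone R phi =
             setT `*` cone_over (standard_cube R ((n * (n - 3)) %/ 2))) &
      (* not a fan *)
      ((6 <= n)%N -> ~ fan (all_faces (kite_cones R n)))].
Proof.
split.
- by move=> U; apply: maximal_linearity_coneP.
- split=> [phi|phi psi f g]; first exact: relint_unique_representation.
  exact: kite_linear_eq.
- by move=> phi; apply: kite_facets.
- by split=> [|phi]; [apply: half_free_pairs|apply: kite_cone_isomorphism].
- exact: kite_cones_not_fan.
Qed.
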